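(* Let $(V,\varphi_V)$ and $(W,\varphi_W)$ be pointwise finite dimensional (PFD) persistence modules such that $(V,W)$ are $(\tau,\sigma)$-interleaved via the morphisms $\phi\colon V\to W(\tau)$ and $\psi\colon W\to V(\sigma)$. Then there exists a matching $\mathcal{X}\colon\mathbf{PD}(V)\nrightarrow\mathbf{PD}(W)$ such that $\mathcal{X}([b,d,i])=[b',d',i']$ implies all of the following relations: $$(\sigma\circ\tau)^{-1}(\langle b,d\rangle)\blacktriangleleft\tau^{-1}(\langle b',d'\rangle),$$ $$\langle b,d\rangle\text{ overlaps }\tau^{-1}(\langle b',d'\rangle)\text{ above},$$ $$\langle b,d\rangle\lhd(\sigma\circ\tau)\big(\tau^{-1}(\langle b',d'\rangle)\big).$$ Moreover, if $[b,d,i]\in\mathbf{PD}(V)$ is unmatched, then it is $(\sigma\circ\tau)$-trivial, and if $[b',d',i']\in\mathbf{PD}(W)$ is unmatched, then either $\langle b',d'\rangle\cap\operatorname{im}\tau=\emptyset$ or $\tau^{-1}(\langle b',d'\rangle)$ is $(\sigma\circ\tau)$-trivial.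
   Context: Fix a field $\mathsf{k}$. A persistence module $V=(V,\varphi_V)$ is a family of $\mathsf{k}$-vector spaces $\{V_t\}_{t\in\mathbb{R}}$ with linear maps $\varphi_V(s,t)\colon V_s\to V_t$ for $s\le t$ such that $\varphi_V(t,t)=\mathrm{id}$ and $\varphi_V(s,t)\circ\varphi_V(r,s)=\varphi_V(r,t)$ for $r\le s\le t$. It is PFD if every $V_t$ is finite-dimensional. A morphism $\phi\colon V\to W$ is a family of linear maps $\phi_t\colon V_t\to W_t$ with $\phi_t\circ\varphi_V(s,t)=\varphi_W(s,t)\circ\phi_s$ for $s\le t$. Interleavings: a translation map is a monotone (non-decreasing) $\sigma\colon\mathbb{R}\to\mathbb{R}$ with $x\le\sigma(x)$ for all $x$. A translation pair is a pair $(\tau,\sigma)$ of monotone functions $\mathbb{R}\to\mathbb{R}$ such that $\tau\circ\sigma$ and $\sigma\circ\tau$ are translation maps. For $\sigma$ monotone, $V(\sigma)$ is the persistence module with $V(\sigma)_t=V_{\sigma(t)}$ and $\varphi_{V(\sigma)}(s,t)=\varphi_V(\sigma(s),\sigma(t))$; for a morphism $\phi$, $\phi(\sigma)_t=\phi_{\sigma(t)}$. For a translation pair $(\tau,\sigma)$, the ordered pair $(V,W)$ is $(\tau,\sigma)$-interleaved via morphisms $\phi\colon V\to W(\tau)$, $\psi\colon W\to V(\sigma)$ if $\psi(\tau)_t\circ\phi_t=\varphi_V(t,(\sigma\circ\tau)(t))$ and $\phi(\sigma)_t\circ\psi_t=\varphi_W(t,(\tau\circ\sigma)(t))$ for all $t\in\mathbb{R}$.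 Decorated points: $\mathbb{E}=\mathbb{R}\times\{-,+\}\cup\{-\infty,\infty\}$, with $t^\pm=(t,\pm)$, ordered lexicographically with $-<+$, minimum $-\infty$, maximum $\infty$. A nonempty interval $J\subseteq\mathbb{R}$ with endpoints $a\le b$ in $\overline{\mathbb{R}}$ is represented by $(\mathcal{B}(J),\mathcal{D}(J))\in\mathbb{E}^2$, where $\mathcal{B}(J)=-\infty$ if $a=-\infty$, $a^-$ if $J$ is left closed, $a^+$ if $J$ is left open; $\mathcal{D}(J)=\infty$ if $b=\infty$, $b^-$ if $J$ is right open, $b^+$ if $J$ is right closed. For $d_1<d_2$ in $\mathbb{E}$, $\langle d_1,d_2\rangle$ is the interval represented by $(d_1,d_2)$. The interval module $I_J$ is $\mathsf{k}$ at $t\in J$ and $0$ otherwise, with identity maps between points of $J$ and zero maps otherwise. Every PFD persistence module is a direct sum of interval modules, uniquely up to reindexing; the persistence diagram $\mathbf{PD}(V)\subset\mathbb{E}\times\mathbb{E}\times\mathbb{N}$ consists of the points $[\mathcal{B}(J),\mathcal{D}(J),k]$, $k=1,\dots,m(I_J)$, for each interval $J$ occurring in the decomposition of $V$ with multiplicity $m(I_J)$. A matching $\mathcal{X}\colon S\nrightarrow T$ is a relation that is the graph of an injective function $S'\to T'$ with $S'\subseteq S$, $T'\subseteq T$; $\mathcal{X}(s)=t$ means $(s,t)\in\mathcal{X}$; a point of $S$ (of $T$) is unmatched if it is not in the domain (image) of this function. For $A,B\subseteq\mathbb{R}$: $A\lhd B$ means for all $y\in B$ there is $x\in A$ with $x\le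 y$; $A\blacktriangleleft B$ means for all $x\in A$ there is $y\in B$ with $x\le y$; ''$B$ overlaps $A$ above'' means $A\lhd B$, $A\blacktriangleleft B$ and $A\cap B\ne\emptyset$. For a translation map $\rho$, an interval $J$ is $\rho$-trivial if $J\cap\rho(J)=\emptyset$, and a point $[b,d,i]$ is $\rho$-trivial if $\langle b,d\rangle$ is. *)

(* Defs.v *)
From HB Require Import structures.
From mathcomp Require Import all_boot all_order all_algebra.
From mathcomp Require Import mathcomp_extra boolp classical_sets functions.
From mathcomp Require Import cardinality fsbigop reals.

Set Implicit Arguments.
Unset Strict Implicit.
Unset Printing Implicit Defensive.

Import Order.TTheory GRing.Theory Num.Theory.
Local Open Scope classical_set_scope.
Local Open Scope card_scope.
Local Open Scope ring_scope.

(* A [vectType k] is a finite-dimensional vector space, so that a family of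
   these makes the module pointwise finite dimensional. *)
Record pfdModule (k : fieldType) (R : realType) := PfdModule {
  pm_space :> R -> vectType k;
  pm_map : forall s t : R, s <= t -> 'Hom(pm_space s, pm_space t);
  pm_map_id : forall (t : R) (tt : t <= t), pm_map tt = \1%VF;
  pm_map_comp : forall (r s t : R) (rs : r <= s) (st : s <= t) (rt : r <= t),
    (pm_map st \o pm_map rs)%VF = pm_map rt }.

Arguments pm_map {k R} p {s t}.

Record pm_morphism (k : fieldType) (R : realType) (V W : pfdModule k R) :=
  Morphism {
    mor_map :> forall t : R, 'Hom(V t, W t);
    mor_natural : forall (s t : R) (st : s <= t),
      (mor_map t \o pm_map V st)%VF = (pm_map W st \o mor_map s)%VF }.

Section Interleavings.
Variable R : realType.

Definition monotone (sigma : R -> R) : Prop := {homo sigma : x y / x <= y}.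

Definition translation_map (sigma : R -> R) : Prop :=
  monotone sigma /\ forall x, x <= sigma x.

Record translation_pair (tau sigma : R -> R) : Prop := TranslationPair {
  tp_monotone1 : monotone tau;
  tp_monotone2 : monotone sigma;
  tp_translation12 : translation_map (tau \o sigma);
  tp_translation21 : translation_map (sigma \o tau) }.

Variable k : fieldType.

Definition pm_reindex (V : pfdModule k R) (sigma : R -> R)
    (sigma_mono : monotone sigma) : pfdModule k R :=
  @PfdModule k R (fun t => V (sigma t))
    (fun s t st => pm_map V (sigma_mono s t st))
    (fun t tt => pm_map_id V (sigma_mono t t tt))
    (fun r s t rs st rt => pm_map_comp V
       (sigma_mono r s rs) (sigma_mono s t st) (sigma_mono r t rt)).

Definition interleaved_via (tau sigma : R -> R)
    (tp : translation_pair tau sigma) (V W : pfdModule k R)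
    (phi : pm_morphism V (pm_reindex W (tp_monotone1 tp)))
    (psi : pm_morphism W (pm_reindex V (tp_monotone2 tp))) : Prop :=
  (forall t : R, (psi (tau t) \o phi t)%VF
     = pm_map V ((tp_translation21 tp).2 t)) /\
  (forall t : R, (phi (sigma t) \o psi t)%VF
     = pm_map W ((tp_translation12 tp).2 t)).

End Interleavings.

(* The decorated points are the bounds of MathComp intervals:
   -oo and +oo are the two infinite points, t^- is [BLeft t], t^+ is
   [BRight t], and the order is the canonical one, [BLeft t < BRight t].
   A closed left end a is [BLeft a] = a^- and an open one [BRight a] = a^+;
   a closed right end b is [BRight b] = b^+ and an open one [BLeft b] = b^-.
   Thus [Interval d1 d2] is the interval represented by (d1, d2). *)
Notation decorated R := (itv_bound R).

Definition dinterval (R : realType) (d1 d2 : decorated R) : set R :=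
  [set` Interval d1 d2].

Section IntervalModule.
Variables (k : fieldType) (R : realType) (d1 d2 : decorated R).

(* The Boolean [t \in Interval d1 d2] is used as a dimension: the space is
   ['rV_1], that is k, on the interval and ['rV_0] off it.  The constant
   matrix of ones is then the identity when both dimensions are 1; otherwise
   the source or the target is 0. *)
Definition imod_space (t : R) : vectType k :=
  'rV[k]_(nat_of_bool (t \in Interval d1 d2)).

Definition imod_map (s t : R) (_ : s <= t) : 'Hom(imod_space s, imod_space t) :=
  linfun (fun v : imod_space s =>
    v *m const_mx 1 :> 'rV[k]_(nat_of_bool (t \in Interval d1 d2))).

Lemma imod_mapE (s t : R) (st : s <= t) (v : imod_space s) :
  imod_map st v = v *m const_mx 1.
Proof. exact: (lfunE (mulmxr _) v). Qed.

Lemma imod_map_id (t : R) (tt : t <= t) : imod_map tt = \1%VF.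
Proof.
apply/lfunP => v; rewrite imod_mapE id_lfunE.
rewrite /imod_space in v *; case: (t \in _) v => v; last by rewrite !thinmx0.
by apply/rowP => j; rewrite mxE big_ord1 mxE mulr1 !ord1.
Qed.

Lemma imod_map_comp (r s t : R) (rs : r <= s) (st : s <= t) (rt : r <= t) :
  (imod_map st \o imod_map rs)%VF = imod_map rt.
Proof.
apply/lfunP => v; rewrite comp_lfunE !imod_mapE -mulmxA; congr (_ *m _).
apply/matrixP => i j; rewrite !mxE.
have ri : r \in Interval d1 d2 by case: (r \in _) i => // -[].
have ti : t \in Interval d1 d2 by case: (t \in _) j => // -[].
have si : s \in Interval d1 d2.
  move: ri ti; rewrite !itv_boundlr => /andP[ri _] /andP[_ ti].
  by rewrite (le_trans ri) ?(le_trans _ ti) // bnd_simp.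
by rewrite si big_ord1 !mxE mulr1.
Qed.

Definition interval_module : pfdModule k R :=
  PfdModule imod_map_id imod_map_comp.

End IntervalModule.

Section Diagram.
Variables (k : fieldType) (R : realType).

(* The morphisms [iota i] exhibit V as the direct sum of the modules M i:
   at every t, each vector of V t is uniquely a sum of images of a finitely
   supported family of vectors. *)
Definition is_direct_sum (V : pfdModule k R) (I : choiceType)
    (M : I -> pfdModule k R) (iota : forall i, pm_morphism (M i) V) : Prop :=
  forall (t : R) (v : V t), exists! x : forall i, M i t,
    finite_set [set i | x i != 0] /\
    v = \sum_(i \in [set: I]) iota i t (x i).

Record interval_decomposition (V : pfdModule k R) := IntervalDecomposition {
  dec_index : choiceType;
  dec_birth : dec_index -> decorated R;
  dec_death : dec_index -> decorated R;
  dec_nonempty : forall i, (dec_birth i < dec_death i)%O;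
  dec_inj : forall i,
    pm_morphism (interval_module k (dec_birth i) (dec_death i)) V;
  dec_sum : is_direct_sum dec_inj }.

(* [b, d, j] belongs to the diagram when 1 <= j <= m, where m is the
   multiplicity of the interval <b, d>. *)
Definition diagram_of (V : pfdModule k R) (D : interval_decomposition V) :
    set (decorated R * decorated R * nat) :=
  [set p | exists m : nat,
     [set i : dec_index D | dec_birth i = p.1.1 /\ dec_death i = p.1.2]
       #= `I_m
     /\ (1 <= p.2 <= m)%N].

(* A decomposition exists, and is unique up to reindexing, for every V, so
   that the choice made by [xget] is immaterial and its default unused. *)
Definition PD (V : pfdModule k R) : set (decorated R * decorated R * nat) :=
  xget set0 [set P | exists D : interval_decomposition V, P = diagram_of D].

End Diagram.

Definition is_matching (S T : Type) (A : set S) (B : set T)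
    (X : S -> T -> Prop) : Prop :=
  [/\ forall s t, X s t -> A s /\ B t,
      forall s t t', X s t -> X s t' -> t = t'
    & forall s s' t, X s t -> X s' t -> s = s'].

Definition unmatched_source (S T : Type) (X : S -> T -> Prop) (s : S) : Prop :=
  forall t, ~ X s t.

Definition unmatched_target (S T : Type) (X : S -> T -> Prop) (t : T) : Prop :=
  forall s, ~ X s t.

Section Overlap.
Variable R : realType.

(* A <| B, with a white triangle *)
Definition bounds_below (A B : set R) : Prop :=
  forall y, B y -> exists2 x, A x & x <= y.

(* A <| B, with a black triangle *)
Definition bounded_above_by (A B : set R) : Prop :=
  forall x, A x -> exists2 y, B y & x <= y.

Definition overlaps_above (B A : set R) : Prop :=
  [/\ bounds_below A B, bounded_above_by A B & A `&` B !=set0].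

Definition trivial_for (rho : R -> R) (J : set R) : Prop :=
  J `&` (rho @` J) = set0.

End Overlap.

(* Main.v *)
From HB Require Import structures.
Require Import Defs.
From mathcomp Require Import all_boot all_order all_algebra finmap.
From mathcomp Require Import boolp classical_sets.
From mathcomp Require Import cardinality fsbigop reals set_interval.
From mathcomp Require Import num_normedtype normed_module.

Set Implicit Arguments.
Unset Strict Implicit.
Unset Printing Implicit Defensive.

Import Order.TTheory GRing.Theory Num.Theory.
Local Open Scope classical_set_scope.
Local Open Scope ring_scope.

(* The proof follows Bauer and Lesnick. Put rho = sigma o tau and let Q be the
   image of phi : V -> W(tau). Since ker phi lies in the kernel of the shift
   V -> V(rho), ranks of the maps V_s -> V_t bound those of Q from both sides;
   for a fixed birth, matching the n-th longest bar of Q to the n-th longest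
   bar of V is then an injection that reaches every rho-nontrivial bar of V.
   Dually, Q and W(tau) are matched with deaths fixed, and the two injections
   are composed through the bars of Q.
   That V, W and Q have bars at all is Crawley-Boevey's theorem, proved by
   functorial filtrations: the bars with support J are families of compatible
   vectors in V+ = im+ meet ker+ that form a basis modulo
   V- = (im- meet ker+) + (im+ meet ker-), and over all J they form a basis at
   every point because images and kernels are two flags of a finite-dimensional
   space. *)

(** * Linear algebra *)

(** Ranks between points do not show whether a birth is open or closed. A birth is therefore an
    up-set U, and the bars born exactly at U and alive at y are counted by a difference of two
    ranks, from a point s just inside U and a point s' just outside. Only finitely many bars pass
    through y, so both counts stabilize near the boundary of U. Each comparison thus needs an
    inequality between ranks and one between differences of ranks, the latter because a linear map
    kills at least as much of a larger subspace. A bar of Q lies in its partner J in V, with the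
    same birth, and in its partner K in W(tau), with the same death; this gives the overlap. For the
    outer relations, if x and rho(x) lie in J then x lies in the bar of Q, and if they lie in K then
    rho(x) does; all other points are settled by their position relative to that bar. W(tau) is
    never decomposed: its bars are the preimages under tau of the bars of W, some of them empty. *)

Section LinearAlgebra.
Variable k : fieldType.

(** The kernel of [f] takes at least as much from [A] as from [B]. With [A] and [B] the images from
    a later and an earlier point, [\dim A - \dim B] counts the bars born in between. *)
Lemma dim_limg_diff (U V : vectType k) (f : 'Hom(U, V)) (A B : {vspace U}) :
  (B <= A)%VS -> (\dim (f @: A) + \dim B <= \dim A + \dim (f @: B))%N.
Proof.
move=> BA; rewrite -(limg_ker_dim f A) -(limg_ker_dim f B).
by rewrite addnCA -addnA leq_add2r dimvS // capvS.
Qed.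

Lemma dim_limg_le (U V : vectType k) (f : 'Hom(U, V)) (A : {vspace U}) :
  (\dim (f @: A) <= \dim A)%N.
Proof. by rewrite -(limg_ker_dim f A) leq_addl. Qed.

(** A subspace of maximal dimension inside [P] is all of [P], since a further vector of [P] would
    enlarge it. This gives the filtration predicates a dimension. *)
Lemma vspace_of_pred (U : vectType k) (P : set U) : P 0 ->
  (forall a u v, P u -> P v -> P (a *: u + v)) ->
  exists A : {vspace U}, forall v, v \in A <-> P v.
Proof.
move=> P0 Plin; pose Q n := `[< exists2 A : {vspace U},
  \dim A = n & forall v, v \in A -> P v >].
have exQ : exists n, Q n.
  by exists 0%N; apply/asboolP; exists 0%VS; rewrite ?dimv0 // => v;
    rewrite memv0 => /eqP ->.
have ubQ n : Q n -> (n <= \dim {:U})%N.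
  by move=> /asboolP[A <- _]; rewrite dimvS ?subvf.
case: (ex_maxnP exQ ubQ) => n /asboolP[A dA AP] nmax.
exists A => v; split=> [/AP //|Pv].
have : Q (\dim (A + <[v]>)%VS).
  apply/asboolP; exists (A + <[v]>)%VS => // w /memv_addP[a aA [b /vlineP[c ->] ->]].
  by rewrite addrC; apply: Plin => //; exact: AP.
move=> /nmax; rewrite -dA => le; suff: (A == A + <[v]>)%VS.
  by move=> /eqP ->; rewrite memvE addvSr.
by rewrite eqEdim addvSl.
Qed.

Lemma memv_span_map (U : vectType k) (I : choiceType) (f : I -> U)
    (s : seq I) (v : U) : uniq s ->
  v \in <<map f s>>%VS <-> exists c : I -> k, v = \sum_(i <- s) c i *: f i.
Proof.
move=> us; split=> [|[c ->]]; last first.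
  rewrite big_seq; apply: memv_suml => i si; apply: memvZ.
  by apply: memv_span; exact: map_f.
elim: s us v => [_ v|i s ih /= /andP[nis us] v].
  by rewrite span_nil memv0 => /eqP ->; exists (fun=> 0); rewrite big_nil.
rewrite span_cons => /memv_addP[_ /vlineP[a ->] [w /(ih us)[c ->] ->]].
exists (fun j => if j == i then a else c j); rewrite big_cons eqxx.
congr (_ + _); rewrite !big_seq; apply: eq_bigr => j js; case: eqP => // ji.
by move: nis; rewrite -ji js.
Qed.

Lemma free_map (U : vectType k) (I : choiceType) (f : I -> U) (s : seq I) :
  uniq s ->
  free (map f s) <->
  forall c : I -> k, \sum_(i <- s) c i *: f i = 0 -> {in s, forall i, c i = 0}.
Proof.
elim: s => [_|i s ih /= /andP[nis us]].
  by split=> // _; rewrite /= nil_free.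
rewrite free_cons; split=> [/andP[nf /(ih us) fs] c|fs].
  rewrite big_cons => e.
  have ci : c i = 0.
    apply/eqP; apply: contraNT nf => ci0; apply/memv_span_map => //.
    exists (fun j => - (c i)^-1 * c j).
    under eq_bigr do rewrite -scalerA.
    rewrite -scaler_sumr -(addKr (c i *: f i) (\sum_(j <- s) _)) e addr0.
    by rewrite scalerN scaleNr opprK scalerA mulVf // scale1r.
  move: e; rewrite ci scale0r add0r => /fs cs j.
  by rewrite in_cons => /orP[/eqP -> //|/cs].
apply/andP; split; last first.
  apply/ih => // c cs j js.
  have := fs (fun j => if j == i then 0 else c j); rewrite big_cons eqxx scale0r.
  rewrite add0r => /(_ _ j); rewrite in_cons js orbT; case: eqP => [ji|_].
    by move: nis; rewrite -ji js.
  apply=> //; rewrite -[RHS]cs !big_seq; apply: eq_bigr => l ls.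
  by case: eqP => // li; move: nis; rewrite -li ls.
apply/negP => /(memv_span_map f (f i) us)[c ei].
have := fs (fun j => if j == i then -1 else c j); rewrite big_cons eqxx.
move=> /(_ _ i); rewrite mem_head eqxx => h.
suff /h /(_ isT) /eqP : -1 *: f i + \sum_(j <- s) (if j == i then -1 else c j) *: f j = 0.
  by rewrite oppr_eq0 oner_eq0.
rewrite scaleN1r {1}ei -[RHS](addNr (\sum_(j <- s) c j *: f j)); congr (_ + _).
rewrite !big_seq; apply: eq_bigr => l ls.
by case: eqP => // li; move: nis; rewrite -li ls.
Qed.

End LinearAlgebra.

Section StructureMaps.
Variables (k : fieldType) (R : realType).
Implicit Types (V : pfdModule k R) (r s t : R).

(* The structure map without its proof argument, with junk value 0 when the
   points are in the wrong order. *)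
Definition pmf V s t : 'Hom(V s, V t) :=
  if pselect (s <= t) is left st then pm_map V st else 0.

Lemma pmfE V s t (st : s <= t) : pmf V s t = pm_map V st.
Proof.
rewrite /pmf; case: pselect => // st'.
by congr (pm_map V _); exact: bool_irrelevance.
Qed.

Lemma pmf_id V t (v : V t) : pmf V t t v = v.
Proof. by rewrite (pmfE V (lexx t)) pm_map_id id_lfunE. Qed.

Lemma pmf_comp V r s t (v : V r) : r <= s -> s <= t ->
  pmf V s t (pmf V r s v) = pmf V r t v.
Proof.
move=> rs st; have rt := le_trans rs st.
by rewrite (pmfE V rs) (pmfE V st) (pmfE V rt) -(pm_map_comp V rs st rt) comp_lfunE.
Qed.

Lemma pmf_limg_comp V r s t (A : {vspace V r}) : r <= s -> s <= t ->
  (pmf V s t @: (pmf V r s @: A) = pmf V r t @: A)%VS.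
Proof.
move=> rs st; rewrite -limg_comp; apply: eq_in_limg => v _.
by rewrite comp_lfunE pmf_comp.
Qed.

End StructureMaps.

(** * Existence of barcodes *)

(** An interval decomposition in coordinates: [x i t] is the image of 1 from the i-th summand.
    Supports are plain sets, so endpoints need not be named before the diagram is read off. *)
Record barcode_basis (k : fieldType) (R : realType) (V : pfdModule k R)
    (I : choiceType) (J : I -> set R) (x : forall (i : I) (t : R), V t) : Prop :=
  BarcodeBasis {
    bar_interval : forall i, is_interval (J i);
    bar_nonempty : forall i, J i !=set0;
    bar_off : forall i t, ~ J i t -> x i t = 0;
    bar_map : forall i s t, s <= t -> J i s -> pmf V s t (x i s) = x i t;
    bar_finite : forall t, finite_set [set i | J i t];
    bar_basis : forall t,
      basis_of fullv [seq x i t | i <- fset_set [set i | J i t]] }.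

(** * The functorial filtration attached to an interval *)

Section Filtration.
Variables (k : fieldType) (R : realType) (V : pfdModule k R) (J : set R).
Implicit Types (r s t : R).

(* For t in J, a point s <= t outside J lies before the left end l of J and a
   point r >= t outside J lies after its right end u. The predicates below are
   thus the images from l^+ and l^- and the kernels to u^+ and u^- of the
   functorial filtration method. *)
Definition im_plus t (v : V t) := forall s, J s -> s <= t -> v \in limg (pmf V s t).
Definition im_minus t (v : V t) :=
  v = 0 \/ exists s, [/\ ~ J s, s <= t & v \in limg (pmf V s t)].
Definition ker_plus t (v : V t) := forall r, ~ J r -> t <= r -> pmf V t r v = 0.
Definition ker_minus t (v : V t) := exists r, [/\ J r, t <= r & pmf V t r v = 0].

Definition flt_plus t (v : V t) := im_plus v /\ ker_plus v.
Definition flt_minus t (v : V t) := exists p q : V t,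
  [/\ v = p + q, im_minus p, ker_plus p, im_plus q & ker_minus q].

Lemma limg_pmf_le s s' t : s <= s' -> s' <= t ->
  (limg (pmf V s t) <= limg (pmf V s' t))%VS.
Proof. by move=> ss st; rewrite -(pmf_limg_comp _ ss st) limgS ?subvf. Qed.

Lemma pmf0_le t r r' (v : V t) : t <= r -> r <= r' ->
  pmf V t r v = 0 -> pmf V t r' v = 0.
Proof. by move=> tr rr e; rewrite -(pmf_comp _ tr rr) e linear0. Qed.

Lemma im_plus_lin t a (u v : V t) : im_plus u -> im_plus v -> im_plus (a *: u + v).
Proof. by move=> Pu Pv s Js st; rewrite memvD ?memvZ ?Pu ?Pv. Qed.

Lemma im_minus_lin t a (u v : V t) : im_minus u -> im_minus v -> im_minus (a *: u + v).
Proof.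
move=> [->|[s [Js st us]]]; first by rewrite scaler0 add0r.
move=> [->|[s' [Js' s't vs]]]; first by rewrite addr0; right; exists s; rewrite memvZ.
right; have [ss|/ltW ss] := leP s s'.
  by exists s'; split=> //; rewrite memvD ?memvZ // (subvP (limg_pmf_le ss s't)).
by exists s; split=> //; rewrite memvD ?memvZ // (subvP (limg_pmf_le ss st)).
Qed.

Lemma ker_plus_lin t a (u v : V t) : ker_plus u -> ker_plus v -> ker_plus (a *: u + v).
Proof. by move=> Pu Pv r Jr tr; rewrite linearP /= Pu // Pv // scaler0 addr0. Qed.

Lemma ker_minus_lin t a (u v : V t) : ker_minus u -> ker_minus v -> ker_minus (a *: u + v).
Proof.
move=> [r [Jr tr ur]] [r' [Jr' tr' vr]].
have [rr|/ltW rr] := leP r r'.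
  by exists r'; split=> //; rewrite linearP /= vr (pmf0_le tr rr ur) scaler0 addr0.
by exists r; split=> //; rewrite linearP /= ur (pmf0_le tr' rr vr) scaler0 addr0.
Qed.

Lemma flt_plus_lin t a (u v : V t) : flt_plus u -> flt_plus v -> flt_plus (a *: u + v).
Proof. by move=> [? ?] [? ?]; split; [exact: im_plus_lin|exact: ker_plus_lin]. Qed.

Lemma flt_minus_lin t a (u v : V t) : flt_minus u -> flt_minus v -> flt_minus (a *: u + v).
Proof.
move=> [p [q [-> ? ? ? ?]]] [p' [q' [-> ? ? ? ?]]].
exists (a *: p + p'), (a *: q + q'); split.
- by rewrite scalerDr addrACA.
- exact: im_minus_lin.
- exact: ker_plus_lin.
- exact: im_plus_lin.
- exact: ker_minus_lin.
Qed.

Lemma flt_plus0 t : flt_plus (0 : V t).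
Proof. by split=> [s _ _|s _ _]; rewrite ?mem0v ?linear0. Qed.

Hypothesis Jint : is_interval J.

Lemma interval_lower s t r : J s -> J t -> ~ J r -> r <= t -> r <= s.
Proof.
move=> Js Jt nJr rt; rewrite leNgt; apply/negP => /ltW sr; apply: nJr.
by apply: (Jint Js Jt); rewrite sr.
Qed.

Lemma interval_upper s t r : J s -> J t -> ~ J r -> s <= r -> t <= r.
Proof.
move=> Js Jt nJr sr; rewrite leNgt; apply/negP => /ltW rt; apply: nJr.
by apply: (Jint Js Jt); rewrite sr.
Qed.

Lemma im_minus_im_plus t (v : V t) : J t -> im_minus v -> im_plus v.
Proof.
move=> Jt [-> s _ _|[s' [Js' s't vs]] s Js st]; first exact: mem0v.
exact: (subvP (limg_pmf_le (interval_lower Js Jt Js' s't) st)).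
Qed.

Lemma ker_minus_ker_plus t (v : V t) : J t -> ker_minus v -> ker_plus v.
Proof.
by move=> Jt [r [Jr tr vr]] r' Jr' tr'; apply: (pmf0_le tr _ vr);
  exact: (interval_upper Jt Jr Jr').
Qed.

Lemma flt_minus0 t : J t -> flt_minus (0 : V t).
Proof.
move=> Jt; exists 0, 0; rewrite addr0; split=> //; first by left.
- by case: (flt_plus0 t).
- by case: (flt_plus0 t).
- by exists t; rewrite linear0.
Qed.

(** The images shrink as [s] moves down in [J], so one of least dimension is contained in all the
    others: the intersection that defines im+ is attained. *)
Lemma im_plus_stable t : J t -> exists s, [/\ J s, s <= t &
  forall v : V t, v \in limg (pmf V s t) -> im_plus v].
Proof.
move=> Jt; pose Q n := `[< exists s, [/\ J s, s <= t & \dim (limg (pmf V s t)) = n] >].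
have exQ : exists n, Q n by exists (\dim (limg (pmf V t t))); apply/asboolP; exists t.
case: (ex_minnP exQ) => n /asboolP[s [Js st ds]] nmin.
exists s; split=> // v vs s' Js' s't; apply: subvP vs.
have [ss|/ltW ss] := leP s s'; first exact: limg_pmf_le.
suff /eqP -> : limg (pmf V s' t) == limg (pmf V s t) by [].
by rewrite eqEdim limg_pmf_le //= ds; apply: nmin; apply/asboolP; exists s'.
Qed.

Section Transport.
Variables (s t : R).
Hypotheses (Js : J s) (Jt : J t) (st : s <= t).

Lemma im_plus_map v : im_plus v -> im_plus (pmf V s t v).
Proof.
move=> Pv r Jr rt; have [rs|/ltW sr] := leP r s.
  have /memv_imgP[u _ ->] := Pv r Jr rs.
  by rewrite pmf_comp // memv_img ?memvf.
by rewrite -(pmf_comp _ sr rt) memv_img ?memvf.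
Qed.

Lemma im_minus_map v : im_minus v -> im_minus (pmf V s t v).
Proof.
move=> [->|[r [Jr rs /memv_imgP[u _ ->]]]]; first by left; rewrite linear0.
by right; exists r; rewrite (le_trans rs) // pmf_comp // memv_img ?memvf.
Qed.

Lemma ker_plus_map v : ker_plus v -> ker_plus (pmf V s t v).
Proof. by move=> Pv r Jr tr; rewrite pmf_comp // Pv // (le_trans st). Qed.

Lemma ker_minus_map v : ker_minus v -> ker_minus (pmf V s t v).
Proof.
move=> [r [Jr sr vr]]; have [rt|/ltW tr] := leP r t.
  by exists t; rewrite pmf_comp // (pmf0_le sr rt vr).
by exists r; rewrite pmf_comp.
Qed.

Lemma ker_plus_unmap v : ker_plus (pmf V s t v) -> ker_plus v.
Proof.
move=> Pv r Jr sr; have tr := interval_upper Js Jt Jr sr.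
by rewrite -(pmf_comp _ st tr) Pv.
Qed.

Lemma ker_minus_unmap v : ker_minus (pmf V s t v) -> ker_minus v.
Proof.
by move=> [r [Jr tr vr]]; exists r; rewrite (le_trans st) // -(pmf_comp _ st tr).
Qed.

Lemma im_minus_lift v : im_minus v -> exists2 u, im_minus u & pmf V s t u = v.
Proof.
move=> [->|[r [Jr rt /memv_imgP[u _ ->]]]].
  by exists 0; [left|rewrite linear0].
have rs := interval_lower Js Jt Jr rt.
exists (pmf V r s u); last by rewrite pmf_comp.
by right; exists r; rewrite memv_img ?memvf.
Qed.

(** At a point [a] where the image in [V s] is already stable, [v] has a preimage; pushed to [s], it
    lies in im+. *)
Lemma im_plus_lift v : im_plus v -> exists2 u, im_plus u & pmf V s t u = v.
Proof.
have [a [Ja as_ aP]] := im_plus_stable Js.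
move=> /(_ a Ja (le_trans as_ st)) /memv_imgP[u _ ->].
exists (pmf V a s u); last by rewrite pmf_comp.
by apply: aP; rewrite memv_img ?memvf.
Qed.

Lemma flt_plus_map v : flt_plus v -> flt_plus (pmf V s t v).
Proof. by move=> [? ?]; split; [exact: im_plus_map|exact: ker_plus_map]. Qed.

Lemma flt_minus_map v : flt_minus v -> flt_minus (pmf V s t v).
Proof.
move=> [p [q [-> ? ? ? ?]]]; exists (pmf V s t p), (pmf V s t q).
by rewrite linearD; split=> //; [exact: im_minus_map|exact: ker_plus_map|
  exact: im_plus_map|exact: ker_minus_map].
Qed.

Lemma flt_plus_lift v : flt_plus v -> exists2 u, flt_plus u & pmf V s t u = v.
Proof.
move=> [/im_plus_lift[u iu <-] kv]; exists u => //; split=> //; exact: ker_plus_unmap.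
Qed.

(** Lifting the im- part [p] to [p'] leaves [v - p'], which maps to [q] and so lies in ker-;
    [im_plus v] puts it in im+. With [flt_plus_lift] this makes V+/V- constant along [J]. *)
Lemma flt_minus_unmap v : im_plus v -> flt_minus (pmf V s t v) -> flt_minus v.
Proof.
move=> iv [p [q [e /im_minus_lift[p' ip' ep] kp /im_plus_lift[q' iq' eq] kq]]].
exists p', (v - p'); rewrite addrC subrK; split=> //.
- by apply: ker_plus_unmap; rewrite ep.
- rewrite addrC -scaleN1r; apply: im_plus_lin => //; exact: im_minus_im_plus.
by apply: ker_minus_unmap; rewrite linearB /= e ep addrC addKr.
Qed.

End Transport.
End Filtration.

(** A countable coinitial sequence lets compatible vectors be chosen by recursion. If [J] has no
    least element, rationals separate its points, so one point of [J] below each rational that has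
    any is enough. *)
Lemma coinitial_sequence (R : realType) (J : set R) (t : R) : J t ->
  exists s : nat -> R, [/\ s 0%N = t, forall n, J (s n),
    forall n, s n.+1 <= s n & forall p, J p -> exists n, s n <= p].
Proof.
move=> Jt; have [[m [Jm mP]]|nmin] := pselect (exists m, J m /\ forall p, J p -> m <= p).
  exists (fun n => if n is 0%N then t else m); split=> //; first by case.
    by case=> [|n] //; exact: mP.
  by move=> p /mP mp; exists 1%N.
(* An enumeration of the rationals; a code of no rational yields 0, which only repeats a value. *)
pose q (n : nat) : R := ratr (odflt 0 (@choice.unpickle rat n)).
have /choice[g gP] n : exists y, J y /\ ((exists2 z, J z & z <= q n) -> y <= q n).
  have [[z Jz zq]|nz] := pselect (exists2 z, J z & z <= q n).
    by exists z.
  by exists t; split.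
pose s := fix s n := if n is m.+1 then Order.min (s m) (g m) else t.
have Js n : J (s n).
  by elim: n => //= n Jn; rewrite /Order.min; case: ifP => // _; case: (gP n).
exists s; split=> // [n|p Jp]; first by rewrite /= ge_min lexx.
have [p' [Jp' pp]] : exists p', J p' /\ p' < p.
  apply: contrapT => np; apply: nmin; exists p; split=> // p' Jp'.
  by rewrite leNgt; apply/negP => pp; apply: np; exists p'.
have [r] := rat_in_itvoo pp; rewrite in_itv /= => /andP[p'r rp].
exists (choice.pickle r).+1; rewrite /= ge_min; apply/orP; right.
have [_] := gP (choice.pickle r); rewrite /q choice.pickleK /= => h.
by apply: (le_trans _ (ltW rp)); apply: h; exists p' => //; exact: ltW.
Qed.

(** * Compatible families of vectors *)

Section Threads.
Variables (k : fieldType) (R : realType) (V : pfdModule k R).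

(** An inverse limit of surjections: [v] is lifted down a coinitial sequence by [flt_plus_lift], and
    the lifts are pushed forward to the other points of [J]. *)
Lemma thread_exists (J : set R) (t0 : R) (v : V t0) :
  is_interval J -> J t0 -> flt_plus J v ->
  exists x : forall t, V t, [/\ x t0 = v, forall t, ~ J t -> x t = 0,
    forall s t, s <= t -> J s -> pmf V s t (x s) = x t &
    forall t, J t -> flt_plus J (x t)].
Proof.
move=> Jint Jt0 Pv; have [s [s0 Js sS sco]] := coinitial_sequence Jt0.
have sle m n : (m <= n)%N -> s n <= s m.
  by move=> /subnK <-; elim: (n - m)%N => //= l; exact: le_trans (sS _).
have step n : exists g : V (s n) -> V (s n.+1), forall w,
    flt_plus J w -> flt_plus J (g w) /\ pmf V (s n.+1) (s n) (g w) = w.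
  suff /choice[g gP] : forall w : V (s n), exists u : V (s n.+1),
      flt_plus J w -> flt_plus J u /\ pmf V (s n.+1) (s n) u = w by exists g.
  move=> w; have [Pw|nPw] := pselect (flt_plus J w); last by exists 0.
  by have [u Pu uw] := flt_plus_lift Jint (Js n.+1) (Js n) (sS n) Pw; exists u.
pose g n := projT1 (cid (step n)).
have gP n : forall w, flt_plus J w -> flt_plus J (g n w) /\ pmf V (s n.+1) (s n) (g n w) = w.
  exact: (projT2 (cid (step n))).
(* [s 0] equals [t0] only propositionally; the structure map between them carries [v] across. *)
pose u := fix u n : V (s n) :=
  if n is m.+1 then g m (u m) else pmf V t0 (s 0%N) v.
have Pu n : flt_plus J (u n).
  by elim: n => [|n /gP[] //] /=; apply: flt_plus_map; rewrite ?s0.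
have uc m n : (m <= n)%N -> pmf V (s n) (s m) (u n) = u m.
  move=> /subnK <-; elim: (n - m)%N => [|l ih] /=; first by rewrite pmf_id.
  rewrite -[RHS]ih -(pmf_comp _ (sS _) (sle _ _ (leq_addl _ _))).
  by have [_ ->] := gP _ _ (Pu (l + m)%N).
(* By [uc] the index chosen here is immaterial, as [xE] records. *)
pose x t : V t := if pselect (J t /\ exists n, s n <= t) is left h then
  pmf V (s (projT1 (cid h.2))) t (u (projT1 (cid h.2))) else 0.
have xE n t : J t -> s n <= t -> x t = pmf V (s n) t (u n).
  move=> Jt snt; rewrite /x; case: pselect => [[Jt' h]|[]]; last by split=> //; exists n.
  case: cid => m /= smt; case/orP: (leq_total n m) => nm.
    by rewrite -(uc _ _ nm) pmf_comp // sle.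
  by rewrite -(uc _ _ nm) pmf_comp // sle.
have xJ t : J t -> flt_plus J (x t).
  by move=> Jt; have [n snt] := sco _ Jt; rewrite (xE n) //; exact: flt_plus_map.
have x0 t : ~ J t -> x t = 0.
  by move=> nJt; rewrite /x; case: pselect => // -[].
exists x; split=> //.
  by rewrite (xE 0%N) ?s0 //= pmf_comp ?s0 // pmf_id.
move=> r t rt Jr; have [Jt|nJt] := pselect (J t); last first.
  (* Beyond the right end of [J] the vector dies because it lies in ker+. *)
  by rewrite (x0 t nJt); have [_ ->] := xJ _ Jr.
have [n snr] := sco _ Jr.
by rewrite (xE n) // (xE n t) ?pmf_comp // (le_trans snr).
Qed.

End Threads.

Lemma dim_proper (k : fieldType) (U : vectType k) (A B : {vspace U}) :
  (A <= B)%VS -> ~ (B <= A)%VS -> (\dim A < \dim B)%N.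
Proof. by move=> AB /negP nBA; rewrite (ltn_leqif (dimv_leqif_sup AB)). Qed.

(** An infinite [A] would contain a free family longer than the dimension. *)
Lemma finite_set_free (k : fieldType) (U : vectType k) (I : choiceType)
    (f : I -> U) (A : set I) :
  (forall s : seq I, uniq s -> {in s, forall i, A i} -> free (map f s)) ->
  finite_set A.
Proof.
move=> fr; apply: contrapT => /(infinite_set_fset (\dim {:U}).+1).
move=> [B BA dB]; have fB := fr (enum_fset B) (fset_uniq B) BA.
move: dB; rewrite leqNgt => /negP; apply; rewrite ltnS.
rewrite (_ : #|` B| = size (map f (enum_fset B))); last by rewrite size_map.
by move: fB; rewrite /free => /eqP <-; exact: dimvS (subvf _).
Qed.

Lemma ex_argmax_seq (T : eqType) (f : T -> nat) (s : seq T) (x : T) :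
  x \in s -> exists2 y, y \in s & {in s, forall z, (f z <= f y)%N}.
Proof.
elim: s x => // a s ih x _; case: s ih => [_|b s /(_ b (mem_head _ _))[y ys ymax]].
  by exists a; rewrite ?mem_head // => z; rewrite inE => /eqP ->.
have [le|lt] := leqP (f a) (f y).
  exists y; first by rewrite in_cons ys orbT.
  by move=> z; rewrite in_cons => /orP[/eqP ->|/ymax].
exists a; rewrite ?mem_head // => z; rewrite in_cons => /orP[/eqP -> //|/ymax].
by move=> zy; apply: leq_trans zy (ltnW lt).
Qed.

(** * Bars with a given support *)

Section Decomposition.
Variables (k : fieldType) (R : realType) (V : pfdModule k R).
Implicit Types (J : set R) (r s t : R).

Lemma flt_plus_sum J t (I : Type) (l : seq I) (c : I -> k) (f : I -> V t) :
  (forall i, flt_plus J (f i)) -> flt_plus J (\sum_(i <- l) c i *: f i).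
Proof.
move=> Pf; elim/big_ind: _ => [|u v Pu Pv|i _]; first exact: flt_plus0.
  by rewrite -[u]scale1r; exact: flt_plus_lin.
by rewrite -[_ *: _]addr0; apply: flt_plus_lin => //; exact: flt_plus0.
Qed.

(** The multiplicity is the dimension of V+/V- at one point of [J], and transport spreads
    independence and generation along [J]. Every set [J] is allowed, with multiplicity 0 unless it
    is a nonempty interval, so that the blocks can be chosen for all [J] at once. *)
Lemma interval_block J : exists (m : nat) (x : nat -> forall t, V t),
  [/\ (0 < m)%N -> is_interval J /\ J !=set0,
      forall j t, ~ J t -> x j t = 0,
      forall j s t, s <= t -> J s -> pmf V s t (x j s) = x j t,
      forall j t, J t -> flt_plus J (x j t) &
      forall t, J t ->
        (forall c : 'I_m -> k, flt_minus J (\sum_(j < m) c j *: x j t) ->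
           forall j, c j = 0) /\
        (is_interval J -> forall v : V t, flt_plus J v ->
           exists c : 'I_m -> k, flt_minus J (v - \sum_(j < m) c j *: x j t))].
Proof.
have [[Jint [t0 Jt0]]|nJ] := pselect (is_interval J /\ J !=set0); last first.
  exists 0%N, (fun _ _ => 0); split=> // [j s t _ _|j t _|t Jt]; first exact: linear0.
    exact: flt_plus0.
  split=> [c _ []//|Jint]; exfalso; apply: nJ; split=> //; by exists t.
have [SP SPP] := vspace_of_pred (flt_plus0 V J t0) (@flt_plus_lin k R V J t0).
have [SM SMP] := vspace_of_pred (flt_minus0 V Jt0) (@flt_minus_lin k R V J t0).
(* A complement of V- in V+. Indexing its basis by [nat] keeps the type independent of the
   multiplicity; out of range [y j] is 0, which is still in V+. *)
pose C := (SP :\: SM)%VS; pose y j := (vbasis C)`_j.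
have yP j : flt_plus J (y j).
  apply/SPP; apply: (subvP (diffvSl SP SM)); rewrite /y.
  have [jm|jm] := ltnP j (\dim C); last by rewrite nth_default ?size_tuple // mem0v.
  by apply: vbasis_mem; rewrite mem_nth // size_tuple.
pose th j := cid (thread_exists Jint Jt0 (yP j)).
pose x j := projT1 (th j).
have xP j : [/\ x j t0 = y j, forall t, ~ J t -> x j t = 0,
    forall s t, s <= t -> J s -> pmf V s t (x j s) = x j t &
    forall t, J t -> flt_plus J (x j t)] := projT2 (th j).
have xmap j s t : s <= t -> J s -> pmf V s t (x j s) = x j t.
  by have [_ _ + _] := xP j; apply.
have sum_map s t m (c : 'I_m -> k) : s <= t -> J s ->
    pmf V s t (\sum_(j < m) c j *: x j s) = \sum_(j < m) c j *: x j t.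
  move=> st Js; rewrite linear_sum; apply: eq_bigr => j _.
  by rewrite linearZ /= xmap.
have sumP t m (c : 'I_m -> k) : J t -> flt_plus J (\sum_(j < m) c j *: x j t).
  by move=> Jt; apply: flt_plus_sum => j; have [_ _ _] := xP j; exact.
have sum0 m (c : 'I_m -> k) : \sum_(j < m) c j *: x j t0 = \sum_(j < m) c j *: y j.
  by apply: eq_bigr => j _; have [-> _ _ _] := xP j.
have split0 (u : V t0) : flt_plus J u -> exists c : 'I_(\dim C) -> k,
    flt_minus J (u - \sum_(j < \dim C) c j *: x j t0).
  move=> /SPP; rewrite -(addv_diff_cap SP SM) => /memv_addP[a aC [b + ->]].
  rewrite memv_cap => /andP[_ /SMP Mb].
  exists (fun j => coord (vbasis C) j a).
  by rewrite sum0 -(coord_vbasis aC) addrC addKr.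
exists (\dim C), x; split=> //.
- by move=> _; split=> //; exists t0.
- by move=> j; have [] := xP j.
- by move=> j; have [] := xP j.
move=> t Jt; split=> [c Mc|_ v Pv].
  (* The relation is carried to [t0], where the combination lies in [C] and in V-, hence
     vanishes. *)
  have M0 : flt_minus J (\sum_(j < \dim C) c j *: x j t0).
    have [le|/ltW le] := leP t0 t.
      apply: (flt_minus_unmap Jint Jt0 Jt le); first by have [] := sumP t0 _ c Jt0.
      by rewrite sum_map.
    by rewrite -(sum_map t) //; exact: flt_minus_map.
  move: M0; rewrite sum0 => /SMP M0; move/freeP: (basis_free (vbasisP C)); apply.
  apply/eqP; rewrite -memv0 -(capv_diff SP SM) memv_cap M0 andbT.
  apply: memv_suml => j _; apply: memvZ; apply: vbasis_mem.
  by rewrite mem_nth // size_tuple.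
have [le|/ltW le] := leP t0 t.
  have [u Pu <-] := flt_plus_lift Jint Jt0 Jt le Pv.
  have [c Mc] := split0 u Pu; exists c.
  by rewrite -(sum_map t0) // -linearB; exact: flt_minus_map.
have [c Mc] := split0 _ (flt_plus_map le Pv); exists c.
apply: (flt_minus_unmap Jint Jt Jt0 le); last by rewrite linearB /= sum_map.
have [iv _] := Pv; have [is_ _] := sumP t _ c Jt.
by rewrite addrC -scaleN1r; exact: im_plus_lin.
Qed.

End Decomposition.

(** * The bars of all supports together form a basis *)

Section BarcodeExistence.
Variables (k : fieldType) (R : realType) (V : pfdModule k R).
Implicit Types (J : set R) (r s t : R).

Variables (m : set R -> nat) (X : set R -> nat -> forall t, V t).
Hypothesis m_interval : forall J, (0 < m J)%N -> is_interval J /\ J !=set0.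
Hypothesis X_off : forall J j t, ~ J t -> X J j t = 0.
Hypothesis X_map : forall J j s t, s <= t -> J s ->
  pmf V s t (X J j s) = X J j t.
Hypothesis X_flt_plus : forall J j t, J t -> flt_plus J (X J j t).
Hypothesis X_indep : forall J t, J t -> forall c : 'I_(m J) -> k,
  flt_minus J (\sum_(j < m J) c j *: X J j t) -> forall j, c j = 0.
Hypothesis X_gen : forall J t, J t -> is_interval J -> forall v : V t,
  flt_plus J v -> exists c : 'I_(m J) -> k,
    flt_minus J (v - \sum_(j < m J) c j *: X J j t).

(** [{classic _}] gives sets of reals the choice structure that an index type needs. *)
Definition bar_index : choiceType :=
  {p : {classic (set R)} * nat | (p.2 < m p.1)%N}.
Definition bar_set (p : bar_index) : set R := (val p).1.
Definition bar_vect (p : bar_index) (t : R) : V t := X (val p).1 (val p).2 t.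

Lemma bar_index_interval (p : bar_index) : is_interval (bar_set p).
Proof. by case: p => [[J j] jm]; case: (m_interval (leq_trans _ jm)). Qed.

Definition bar_ord J (j : 'I_(m J)) : bar_index :=
  exist (fun p : {classic (set R)} * nat => (p.2 < m p.1)%N) (J, nat_of_ord j)
    (ltn_ord j).

Lemma bar_ord_inj J : injective (@bar_ord J).
Proof. by move=> i j /(congr1 val) [] /val_inj. Qed.

Lemma bar_ord_surj (p : bar_index) : exists j, @bar_ord (bar_set p) j = p.
Proof. by case: p => [[J j] jm]; exists (Ordinal jm); exact: val_inj. Qed.

Section AtPoint.
Variable t : R.

(** The whole block of [J] is summed, with coefficient 0 off [s], to fit the form of [X_indep]. *)
Lemma bar_block_sum J (s : seq bar_index) (c : bar_index -> k) : uniq s ->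
  \sum_(p <- s | (bar_set p : {classic (set R)}) == J) c p *: bar_vect p t =
  \sum_(j < m J) (if bar_ord j \in s then c (bar_ord j) else 0) *: X J j t.
Proof.
move=> us; rewrite -big_filter.
pose l := [seq p <- map (@bar_ord J) (enum 'I_(m J)) | p \in s].
rewrite (perm_big l) /=; last first.
  apply: uniq_perm; rewrite ?filter_uniq //.
    by rewrite map_inj_uniq ?enum_uniq //; exact: bar_ord_inj.
  move=> p; rewrite !mem_filter andbC; case: (p \in s) => //=.
  apply/eqP/mapP => [pJ|[j _ ->] //].
  case: p pJ => [[J' j] /= jm]; rewrite /bar_set /= => e; move: jm; rewrite e => jm.
  by exists (Ordinal jm); rewrite ?mem_enum //; exact: val_inj.
rewrite big_filter big_map big_enum_cond /= big_mkcond /=.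
by apply: eq_bigr => j _; case: ifP => // _; rewrite scale0r.
Qed.

(* Contains all bars at t that precede J when bars are ordered by birth and,
   for equal births, by death. *)
Definition below_bar J (v : V t) := exists a b : V t,
  [/\ v = a + b, im_minus J a, im_plus J b & ker_minus J b].

Lemma below_bar_lin J a (u v : V t) :
  below_bar J u -> below_bar J v -> below_bar J (a *: u + v).
Proof.
move=> [p [q [-> ? ? ?]]] [p' [q' [-> ? ? ?]]].
exists (a *: p + p'), (a *: q + q'); split; first by rewrite scalerDr addrACA.
- exact: im_minus_lin.
- exact: im_plus_lin.
- exact: ker_minus_lin.
Qed.

Lemma im_minus_below_bar J (v : V t) : J t -> im_minus J v -> below_bar J v.
Proof.
move=> Jt iv; exists v, 0; split; rewrite ?addr0 //; last by exists t; rewrite linear0.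
by case: (flt_plus0 V J t).
Qed.

(** The component [a = v - b] lies in ker+: [v] does by assumption, and [b] because ker- is inside
    ker+. *)
Lemma below_bar_flt_minus J (v : V t) : is_interval J -> J t ->
  flt_plus J v -> below_bar J v -> flt_minus J v.
Proof.
move=> Jint Jt [_ kv] [a [b [e ia ib kb]]]; exists a, b; split=> //.
suff -> : a = (-1) *: b + v by apply: ker_plus_lin => //; exact: ker_minus_ker_plus.
by rewrite e scaleN1r addrC addrK.
Qed.

Lemma bar_vect_nflt_minus (p : bar_index) : bar_set p t -> ~ flt_minus (bar_set p) (bar_vect p t).
Proof.
case: p => [[J j] jm] Jt; rewrite /bar_set /bar_vect /= in Jt * => Mx.
have := X_indep Jt (c := fun i => (i == Ordinal jm)%:R).
rewrite (bigD1 (Ordinal jm)) //= eqxx scale1r big1 ?addr0; last first.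
  by move=> i /negPf ->; rewrite scale0r.
by move=> /(_ Mx (Ordinal jm)) /eqP; rewrite eqxx oner_eq0.
Qed.

Definition im_space J : {vspace V t} := projT1 (cid (@vspace_of_pred k (V t)
  (@im_plus k R V J t) (flt_plus0 V J t).1 (@im_plus_lin k R V J t))).
Definition ker_space J : {vspace V t} := projT1 (cid (@vspace_of_pred k (V t)
  (@ker_plus k R V J t) (flt_plus0 V J t).2 (@ker_plus_lin k R V J t))).

Lemma im_spaceP J v : v \in im_space J <-> im_plus J v.
Proof. exact: (projT2 (cid (@vspace_of_pred k (V t) _ _ _))). Qed.

Lemma ker_spaceP J v : v \in ker_space J <-> ker_plus J v.
Proof. exact: (projT2 (cid (@vspace_of_pred k (V t) _ _ _))). Qed.

(** The lexicographic order on two dimensions as one number: the factor exceeds every possible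
    second dimension. *)
Definition bar_weight (p : bar_index) : nat :=
  (\dim (im_space (bar_set p)) * (\dim {: V t}).+1 + \dim (ker_space (bar_set p)))%N.

Lemma bar_weight_lt_im (p q : bar_index) :
  (\dim (im_space (bar_set p)) < \dim (im_space (bar_set q)))%N ->
  (bar_weight p < bar_weight q)%N.
Proof.
move=> lt; rewrite /bar_weight.
have h := dimvS (subvf (ker_space (bar_set p))).
rewrite -ltnS in h; apply: (@leq_trans ((\dim (im_space (bar_set p))).+1 * (\dim {:V t}).+1)).
  by rewrite mulSn addnC ltn_add2r.
by rewrite (leq_trans _ (leq_addr _ _)) // leq_mul2r lt orbT.
Qed.

(** The weight stands in for the order by birth, then death. If the support of [q] began earlier, or
    began alike and ended earlier, [bar_vect p t] would witness a strict inclusion that gives [q]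
    the smaller weight. *)
Lemma bar_below (p q : bar_index) : bar_set p t -> bar_set q t ->
  bar_set p <> bar_set q -> (bar_weight p <= bar_weight q)%N ->
  below_bar (bar_set q) (bar_vect p t).
Proof.
set J := bar_set p; set K := bar_set q => Jt Kt JK wpq.
have Jint : is_interval J by exact: bar_index_interval.
have Kint : is_interval K by exact: bar_index_interval.
have [iJ kJ] : flt_plus J (bar_vect p t) by exact: X_flt_plus.
have xJ : ~ flt_minus J (bar_vect p t) by exact: bar_vect_nflt_minus.
have [[r [Jr nKr rt]]|h1] := pselect (exists r, [/\ J r, ~ K r & r <= t]).
  apply: im_minus_below_bar => //; right; exists r; split=> //.
  by rewrite /bar_vect -(X_map _ rt Jr) memv_img ?memvf.
have [[r [Kr nJr rt]]|h2] := pselect (exists r, [/\ K r, ~ J r & r <= t]).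
  exfalso; move: wpq; rewrite leqNgt => /negP; apply; apply: bar_weight_lt_im.
  have KJ (v : V t) : im_plus K v -> im_minus J v by move=> iv; right; exists r; split=> //; exact: iv.
  apply: dim_proper.
    by apply/subvP => v /im_spaceP /KJ iv; apply/im_spaceP; exact: im_minus_im_plus.
  move=> /subvP /(_ (bar_vect p t)) h; apply: xJ.
  have /KJ ix : im_plus K (bar_vect p t) by apply/im_spaceP/h/im_spaceP.
  exists (bar_vect p t), 0; rewrite addr0; split=> //.
    by case: (flt_plus0 V J t).
  by exists t; rewrite linear0.
have JKl s : s <= t -> J s <-> K s.
  move=> st; split=> [Js|Ks].
    by apply: contrapT => nK; apply: h1; exists s.
  by apply: contrapT => nJ; apply: h2; exists s.
have imJK (v : V t) : im_plus J v <-> im_plus K v.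
  by split=> iv s /[swap] st /(JKl _ st) Js; exact: iv.
have [[r [Kr nJr tr]]|h3] := pselect (exists r, [/\ K r, ~ J r & t <= r]).
  exists 0, (bar_vect p t); rewrite add0r; split=> //; first by left.
    exact/imJK.
  by exists r; split=> //; rewrite /bar_vect (X_map _ tr) // X_off.
have [[r [Jr nKr tr]]|h4] := pselect (exists r, [/\ J r, ~ K r & t <= r]).
  exfalso; move: wpq; rewrite leqNgt => /negP; apply; rewrite /bar_weight.
  have -> : im_space (bar_set p) = im_space (bar_set q).
    apply/vspaceP => v; apply/idP/idP => /im_spaceP h; apply/im_spaceP; exact/imJK.
  rewrite ltn_add2l; apply: dim_proper.
    apply/subvP => v /ker_spaceP kv; apply/ker_spaceP; apply: ker_minus_ker_plus => //.
    by exists r; split=> //; exact: kv.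
  move=> /subvP /(_ (bar_vect p t)) h; apply: xJ.
  exists 0, (bar_vect p t); rewrite add0r; split=> //; first by left.
    by case: (flt_plus0 V J t).
  by exists r; split=> //; have /ker_spaceP := h ((ker_spaceP _ _).2 kJ); exact.
exfalso; apply: JK; apply/seteqP; split=> r.
  have [rt|/ltW tr] := leP r t; first by move/(JKl _ rt).
  by move=> Jr; apply: contrapT => nK; apply: h4; exists r.
have [rt|/ltW tr] := leP r t; first by move/(JKl _ rt).
by move=> Jr; apply: contrapT => nK; apply: h3; exists r.
Qed.

(** In a nontrivial relation take a bar [p] of maximal weight: every occurring bar of another
    support falls into [below_bar], so the block of [p] lies in V-, against its independence modulo
    V-. *)
Lemma bar_free (s : seq bar_index) : uniq s -> {in s, forall p, bar_set p t} ->
  free [seq bar_vect p t | p <- s].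
Proof.
move=> us st; apply/free_map => // c c0 p0 p0s; apply: contrapT => cp0.
have p0s' : p0 \in [seq p <- s | c p != 0] by rewrite mem_filter p0s andbT; exact/eqP.
have [p] := ex_argmax_seq bar_weight p0s'.
rewrite mem_filter => /andP[cp ps] pmax {p0 p0s cp0 p0s'}.
have Jt := st p ps; set J := bar_set p in Jt *.
have Jint : is_interval J by exact: bar_index_interval.
move: c0; rewrite (bigID (fun q => (bar_set q : {classic (set R)}) == J)) /=.
rewrite bar_block_sum // => /eqP; rewrite addr_eq0 => /eqP e.
have Z : below_bar J (\sum_(q <- s | (bar_set q : {classic (set R)}) != J)
    c q *: bar_vect q t).
  rewrite big_seq_cond; elim/big_rec: _ => [|q v /andP[qs qJ] bv].
    by apply: im_minus_below_bar => //; left.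
  have [-> |cq] := eqVneq (c q) 0; first by rewrite scale0r add0r.
  apply: below_bar_lin => //; apply: bar_below => //; first exact: st.
    exact/eqP.
  by apply: pmax; rewrite mem_filter cq.
have b0 : below_bar J 0 by apply: im_minus_below_bar => //; left.
have MZ : flt_minus J (\sum_(j < m J) (if bar_ord j \in s then c (bar_ord j) else 0) *: X J j t).
  apply: below_bar_flt_minus => //; first by apply: flt_plus_sum => j; exact: X_flt_plus.
  by rewrite e -scaleN1r -[_ *: _]addr0; exact: below_bar_lin.
have [j ej] := bar_ord_surj p.
by have := X_indep Jt MZ j; rewrite /J ej ps => /eqP; rewrite (negPf cp).
Qed.

Lemma bar_finite_at : finite_set [set p | bar_set p t].
Proof. by apply: (@finite_set_free _ _ _ (bar_vect^~ t)) => s us st; exact: bar_free. Qed.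

Definition bar_seq := enum_fset (fset_set [set p | bar_set p t]).

Lemma mem_bar_span (p : bar_index) :
  bar_vect p t \in <<[seq bar_vect p t | p <- bar_seq]>>%VS.
Proof.
have [pt|npt] := pselect (bar_set p t); last by rewrite /bar_vect X_off ?mem0v.
apply/memv_span/map_f; rewrite /bar_seq /= in_fset_set ?inE //; exact: bar_finite_at.
Qed.

(** Induction on the rectangle cut out by an image and a kernel. [J] is where the image still
    contains that from [s] and [B] is not yet killed, so [v] is in V+ of [J]. Modulo bars it is
    [p + q]: [p] is 0 or comes from outside [J], hence from a strictly smaller image, and [q] dies
    inside [J], hence lies in a strictly smaller kernel. *)
Lemma bar_span_rect n (s : R) (B : {vspace V t}) (v : V t) : s <= t ->
  B = fullv \/ (exists2 r, t <= r & B = lker (pmf V t r)) ->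
  (\dim (limg (pmf V s t)) + \dim B < n)%N ->
  v \in limg (pmf V s t) -> v \in B ->
  v \in <<[seq bar_vect p t | p <- bar_seq]>>%VS.
Proof.
elim: n s B v => // n ih s B v st Bk; rewrite ltnS => dn vs vB.
have [->|v0] := eqVneq v 0; first exact: mem0v.
pose J : set R := [set r | (r <= t -> (limg (pmf V s t) <= limg (pmf V r t))%VS) /\
  (t <= r -> ~~ (B <= lker (pmf V t r))%VS)].
have Jt : J t.
  split=> _; first exact: limg_pmf_le.
  by apply/negP => /subvP /(_ v vB); rewrite memv_ker pmf_id (negPf v0).
have kle r r' : t <= r -> r <= r' -> (lker (pmf V t r) <= lker (pmf V t r'))%VS.
  move=> tr rr; apply/subvP => w; rewrite !memv_ker => /eqP e.
  by rewrite (pmf0_le tr rr e).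
have Jint : is_interval J.
  move=> x y [x1 x2] [y1 y2] z /andP[xz zy]; split=> [zt|tz].
    exact: subv_trans (x1 (le_trans xz zt)) (limg_pmf_le _ xz zt).
  apply/negP => Bz; have /negP := y2 (le_trans tz zy); apply.
  exact: subv_trans Bz (kle _ _ tz zy).
have nJge r : ~ J r -> t <= r -> (B <= lker (pmf V t r))%VS.
  move=> nJ tr; apply: contrapT => /negP nB; apply: nJ; split=> // rt.
  by have -> : r = t by [apply/le_anti; rewrite rt]; exact: Jt.1.
have nJle r : ~ J r -> r <= t -> ~ (limg (pmf V s t) <= limg (pmf V r t))%VS.
  move=> nJ rt le; apply: nJ; split=> // tr.
  by have -> : r = t by [apply/le_anti; rewrite rt]; exact: Jt.2.
have PJ : flt_plus J v.
  split=> [r [r1 _] rt|r nJ tr]; first exact: (subvP (r1 rt)).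
  by apply/eqP; rewrite -memv_ker (subvP (nJge _ nJ tr)).
have [c [p [q [e ip kp iq kq]]]] := X_gen Jt Jint PJ.
rewrite -(subrK (\sum_(j < m J) c j *: X J j t) v) e; apply: memvD; last first.
  by apply: memv_suml => j _; apply/memvZ/(mem_bar_span (bar_ord j)).
apply: memvD.
  case: ip => [->|[r [nJ rt pr]]]; first exact: mem0v.
  have rs : r <= s.
    by rewrite leNgt; apply/negP => /ltW sr; apply: (nJle _ nJ rt); exact: limg_pmf_le.
  apply: (ih r B) => //.
    apply: leq_trans dn; rewrite ltn_add2r; apply: dim_proper; first exact: limg_pmf_le.
    exact: nJle.
  (* If [B] is the kernel to [r'], then [r'] is outside [J], and ker+ puts [p] in [B]. *)
  case: Bk nJge => [->|[r' tr' Br']] nJge; first exact: memvf.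
  rewrite Br' memv_ker; apply/eqP; apply: kp => // -[_ /(_ tr') /negP]; apply.
  by rewrite Br'.
case: kq => r [Jr tr qr].
have /negP nB := Jr.2 tr.
have sJ : J s.
  split=> // ts; have -> : s = t by [apply/le_anti; rewrite st]; exact: Jt.2.
apply: (ih s (lker (pmf V t r))) => //.
- by right; exists r.
- apply: leq_trans dn; rewrite ltn_add2l; apply: dim_proper => //.
  case: Bk nB => [->|[r' tr' ->]] nB; first exact: subvf.
  have [rr|/ltW rr] := leP r r'; first exact: kle.
  by case: nB; exact: kle.
- exact: iq.
- by rewrite memv_ker qr.
Qed.

Lemma bar_full : <<[seq bar_vect p t | p <- bar_seq]>>%VS = fullv.
Proof.
apply/vspaceP => v; rewrite memvf.
apply: (@bar_span_rect _ t fullv v _ _ (ltnSn _)); rewrite ?memvf //; first by left.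
by rewrite -[v in v \in _](pmf_id v) memv_img ?memvf.
Qed.

End AtPoint.

Lemma bar_barcode_basis : barcode_basis bar_set bar_vect.
Proof.
split.
- exact: bar_index_interval.
- by case=> [[J j] jm]; case: (m_interval (leq_trans _ jm)).
- by move=> i t; exact: X_off.
- by move=> i s t; exact: X_map.
- exact: bar_finite_at.
- move=> t; rewrite /basis_of bar_full eqxx /=; apply: bar_free; first exact: fset_uniq.
  move=> p; rewrite in_fset_set ?inE //; exact: bar_finite_at.
Qed.

End BarcodeExistence.

Theorem barcode_basis_exists (k : fieldType) (R : realType) (V : pfdModule k R) :
  exists (I : choiceType) (J : I -> set R) (x : forall i t, V t), barcode_basis J x.
Proof.
have /choice[m /choice[X hX]] := interval_block V.
exists (bar_index m), (@bar_set _ m), (@bar_vect _ _ _ m X).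
apply: bar_barcode_basis => J.
- by have [] := hX J.
- by have [] := hX J.
- by have [] := hX J.
- by have [] := hX J.
- by move=> t Jt c; have [_ _ _ _ /(_ t Jt) [+ _]] := hX J; exact.
- by move=> t Jt; have [_ _ _ _ /(_ t Jt) [_ +]] := hX J; exact.
Qed.

(** * Matching nested families of sets *)

Definition ncard (I : choiceType) (A : set I) : nat := #|` fset_set A|.

Section Ncard.
Variable I : choiceType.
Implicit Types A B : set I.

Lemma ncard_le A B : finite_set B -> A `<=` B -> (ncard A <= ncard B)%N.
Proof.
move=> fB AB; apply: fsubset_leq_card.
by rewrite -fset_set_sub //; exact: sub_finite_set AB fB.
Qed.

Lemma ncardID A B : finite_set A -> B `<=` A ->
  (ncard (A `\` B) + ncard B)%N = ncard A.
Proof.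
move=> fA BA; have fB := sub_finite_set BA fA.
rewrite /ncard fset_setD // addnC -(cardfsID (fset_set B) (fset_set A)).
congr (_ + _)%N; congr (#|` _|); apply/esym/fsetIidPr.
by rewrite -fset_set_sub.
Qed.

Lemma ncard_lt A B x : finite_set B -> A `<=` B -> B x -> ~ A x ->
  (ncard A < ncard B)%N.
Proof.
move=> fB AB Bx nAx; apply: fproper_ltn_card; rewrite fproperEneq.
have fA := sub_finite_set AB fB.
apply/andP; split; last by rewrite -fset_set_sub.
by apply/eqP => /(fset_set_inj fA fB) e; apply: nAx; rewrite e.
Qed.

End Ncard.

(* The members of a nested family are ranked by decreasing size; ties, which
   are finite, are broken arbitrarily. *)
Section Ranking.
Variables (I : choiceType) (T : Type) (D : set I) (J : I -> set T).
Hypothesis nested : forall i j, D i -> D j -> J i `<=` J j \/ J j `<=` J i.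
Hypothesis fin : forall x, finite_set [set i | D i /\ J i x].
Hypothesis nonempty : forall i, D i -> J i !=set0.

Let cls i := [set j | D j /\ J j = J i].
Let e i := index i (enum_fset (fset_set (cls i))).
Let prec j i := (J i `<=` J j /\ J i <> J j) \/ (J i = J j /\ (e j < e i)%N).
Let rank i := ncard [set j | D j /\ prec j i].

Let e_inj i j : D i -> D j -> J i = J j -> e i = e j -> i = j.
Proof.
move=> Di Dj ij; have cij : cls i = cls j by rewrite /cls ij.
have fc : finite_set (cls j).
  have [x Jx] := nonempty Dj; apply: sub_finite_set (fin x) => l [Dl lj].
  by split=> //; rewrite lj.
rewrite /e cij; apply: (index_inj i); rewrite in_fset_set // inE; by split.
Qed.

Let prec_sub i j : prec j i -> J i `<=` J j.
Proof. by move=> [[]|[-> _]] //; exact: subset_refl. Qed.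

Let prec_trans i j l : prec j i -> prec l j -> prec l i.
Proof.
move=> [[ij nij]|[ij eij]] [[jl njl]|[jl ejl]].
- left; split; first exact: subset_trans jl.
  by move=> il; apply: nij; apply/seteqP; split=> //; rewrite il.
- by left; rewrite -jl.
- by left; rewrite ij.
- by right; rewrite ij; split=> //; exact: ltn_trans eij.
Qed.

Let prec_irr i : ~ prec i i.
Proof. by move=> [[]//|[_]]; rewrite ltnn. Qed.

Let prec_total i j : D i -> D j -> [\/ prec i j, i = j | prec j i].
Proof.
move=> Di Dj; have [ij|nij] := pselect (J i = J j).
  case: (ltngtP (e i) (e j)) => eij.
  - by constructor 1; right.
  - by constructor 3; right.
  - by constructor 2; exact: e_inj.
by case: (nested Di Dj) => s; [constructor 3|constructor 1]; left; split=> // /esym.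
Qed.

Let prec_fin i : D i -> finite_set [set j | D j /\ prec j i].
Proof.
move=> Di; have [x Jx] := nonempty Di; apply: sub_finite_set (fin x).
by move=> j [Dj /prec_sub ij]; split=> //; exact: ij.
Qed.

Let rank_lt i j : D i -> D j -> prec j i -> (rank j < rank i)%N.
Proof.
move=> Di Dj ji; apply: (@ncard_lt _ _ _ j) => //; first exact: prec_fin.
  by move=> l [Dl lj]; split=> //; exact: prec_trans lj.
by move=> [_ /prec_irr].
Qed.

Let rank_inj i j : D i -> D j -> rank i = rank j -> i = j.
Proof.
move=> Di Dj r; case: (prec_total Di Dj) => // p.
  by have := rank_lt Dj Di p; rewrite r ltnn.
by have := rank_lt Di Dj p; rewrite r ltnn.
Qed.

(** Whatever precedes a member contains it, so the members through [x] form an initial segment. *)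
Let rankP i x : D i -> J i x <-> (rank i < ncard [set i | D i /\ J i x])%N.
Proof.
move=> Di; split=> [Jx|].
  apply: (@ncard_lt _ _ _ i) => //; last by move=> [_ /prec_irr].
  by move=> j [Dj /prec_sub ij]; split=> //; exact: ij.
apply: contraPP => nJx; rewrite ltnNge => /negP; apply.
apply: ncard_le; first exact: prec_fin.
move=> j [Dj Jx]; split=> //; case: (prec_total Di Dj) => // [/prec_sub /(_ x Jx)|] //.
by move=> ij; case: nJx; rewrite ij.
Qed.

Lemma ranking : exists r : I -> nat,
  (forall i j, D i -> D j -> r i = r j -> i = j) /\
  forall x, (forall i, D i -> J i x <-> (r i < ncard [set i | D i /\ J i x])%N) /\
    forall n, (n < ncard [set i | D i /\ J i x])%N ->
      exists i, [/\ D i, J i x & r i = n].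
Proof.
exists rank; split=> // x; split=> [i Di|n nN]; first exact: rankP.
set F := fset_set [set i | D i /\ J i x].
have FP i : i \in enum_fset F -> D i /\ J i x.
  by rewrite in_fset_set ?inE.
have us : uniq (map rank (enum_fset F)).
  rewrite map_inj_in_uniq ?fset_uniq // => i j /FP[Di _] /FP[Dj _].
  exact: rank_inj.
have sub : {subset map rank (enum_fset F) <= iota 0 (ncard [set i | D i /\ J i x])}.
  by move=> _ /mapP[i /FP[Di Jx] ->]; rewrite mem_iota; exact/rankP.
(* As many distinct ranks as there are values below the bound: every value is taken. *)
have [|_ eq] := uniq_min_size us sub; first by rewrite size_iota size_map.
have : n \in map rank (enum_fset F) by rewrite eq mem_iota.
by move=> /mapP[i /FP[Di Jx] ->]; exists i.
Qed.

End Ranking.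

(* Used for <= (matching bars of equal birth) and for >= (equal death): the
   births of bars A and B agree when [up A = up B]. *)
Section HalfMatching.
Variables (T : Type) (le : T -> T -> Prop).
Hypothesis le_refl : forall x, le x x.
Hypothesis le_trans : forall x y z, le x y -> le y z -> le x z.
Hypothesis le_total : forall x y, le x y \/ le y x.

Definition le_convex (A : set T) :=
  forall x y z, A x -> A y -> le x z -> le z y -> A z.
Definition up (A : set T) : set T := [set y | exists2 x, A x & le x y].
(** For a barcode and [s] before [x] this is the rank of the structure map, the only datum that the
    matching uses. *)
Definition cnt (I : choiceType) (J : I -> set T) (s x : T) :=
  ncard [set i | J i s /\ J i x].
Definition fibre (I : choiceType) (J : I -> set T) (U : set T) : set I :=
  [set i | J i !=set0 /\ up (J i) = U].

Let upU A x y : up A x -> le x y -> up A y.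
Proof. by move=> [z Az zx] xy; exists z => //; exact: le_trans xy. Qed.

Let le_upN A x y : up A x -> ~ up A y -> le y x.
Proof. by move=> Ax nAy; case: (le_total x y) => // /(upU Ax). Qed.

Let up_chain A B : ~ (up A `<=` up B) -> up B `<=` up A.
Proof.
move=> /existsNP[x /not_implyP[Ax nBx]] y By.
by apply: upU Ax _; exact: le_upN nBx.
Qed.

Let sub_up A : A `<=` up A.
Proof. by move=> x Ax; exists x. Qed.

Lemma cntC (I : choiceType) (J : I -> set T) s t : cnt J s t = cnt J t s.
Proof. by congr ncard; apply/seteqP; split=> i []. Qed.

Section OneBarcode.
Variables (I : choiceType) (J : I -> set T).
Hypothesis conv : forall i, le_convex (J i).
Hypothesis fin : forall x, finite_set [set i | J i x].

Lemma finite_lower_bound (U : set T) (A : set I) (p : I -> T) (x : T) :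
  finite_set A -> U x -> (forall i, A i -> U (p i)) ->
  exists2 s, U s & le s x /\ forall i, A i -> le s (p i).
Proof.
move=> fA Ux Up; suff: forall l : seq I, exists2 s, U s &
    le s x /\ forall i, i \in l -> A i -> le s (p i).
  move=> /(_ (enum_fset (fset_set A)))[s Us [sx sp]]; exists s => //; split=> // i Ai.
  by apply: sp => //; rewrite in_fset_set // inE.
elim=> [|i l [s Us [sx sp]]]; first by exists x => //; split.
have [Ai|nAi] := pselect (A i); last first.
  exists s => //; split=> // j; rewrite in_cons => /orP[/eqP -> //|]; exact: sp.
case: (le_total s (p i)) => [spi|pis].
  by exists s => //; split=> // j; rewrite in_cons => /orP[/eqP -> //|]; exact: sp.
exists (p i); first exact: Up.
split; first exact: le_trans sx.
move=> j; rewrite in_cons => /orP[/eqP -> //|jl Aj].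
by apply: le_trans pis _; exact: sp.
Qed.

(** Each of the finitely many bars through [x] born strictly inside [up A] misses a point of [up A];
    below all these points only bars born no later remain. *)
Lemma stable_inside (A : set T) x : up A x -> exists2 s0, up A s0 &
  forall s, up A s -> le s s0 -> forall i, J i x -> J i s <-> up A `<=` up (J i).
Proof.
set U := up A => Ux.
have /choice[p pP] i : exists p, ~ (U `<=` up (J i)) -> U p /\ ~ up (J i) p.
  have [h|/existsNP[p /not_implyP[? ?]]] := pselect (U `<=` up (J i)); first by exists x.
  by exists p.
have fA : finite_set [set i | J i x /\ ~ (U `<=` up (J i))].
  by apply: sub_finite_set (fin x) => i [].
have [] := @finite_lower_bound U _ p x fA Ux; first by move=> i [_ /pP[]].
move=> s0 Us0 [s0x s0p]; exists s0 => // s Us ss0 i Jix; split=> [Jis|Ui].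
  apply: contrapT => nU; have [Up nup] := pP i nU; apply: nup.
  by apply: upU (sub_up Jis) _; apply: le_trans ss0 _; exact: s0p.
have [z Jz zs] := Ui s Us.
by apply: (conv Jz Jix zs); exact: le_trans ss0 s0x.
Qed.

(** The alternative covers an [up A] that is everything: then there is no point outside, but also no
    bar born earlier. *)
Lemma stable_outside (A : set T) x : up A x ->
  (forall s i, ~ up A s -> J i s -> ~ (up (J i) `<=` up A)) /\
  ((forall i, J i x -> up (J i) `<=` up A) \/
   exists2 s0, ~ up A s0 & forall s, ~ up A s -> le s0 s ->
     forall i, J i x -> ~ (up (J i) `<=` up A) -> J i s).
Proof.
set U := up A => Ux; split=> [s i nUs Jis h|]; first exact/nUs/h/sub_up.
have [h|nh] := pselect (forall i, J i x -> up (J i) `<=` U); first by left.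
right; have /existsNP[i0 /not_implyP[Ji0 nU0]] := nh.
have /choice[p pP] i : exists p, ~ (up (J i) `<=` U) -> up (J i) p /\ ~ U p.
  have [h|/existsNP[p /not_implyP[? ?]]] := pselect (up (J i) `<=` U); first by exists x.
  by exists p.
pose B := [set i | J i x /\ ~ (up (J i) `<=` U)].
have fB : finite_set B by apply: sub_finite_set (fin x) => i [].
suff [s0 Us0 s0p] : exists2 s0, ~ U s0 & forall i, B i -> le (p i) s0.
  exists s0 => // s nUs s0s i Jx nU; have [[z Jz zp] _] := pP i nU.
  apply: (conv Jz Jx); first exact: le_trans (le_trans zp (s0p i (conj Jx nU))) s0s.
  exact: le_upN nUs.
suff: forall l : seq I, exists2 s, ~ U s & forall i, i \in l -> B i -> le (p i) s.
  move=> /(_ (enum_fset (fset_set B)))[s Us sp]; exists s => // i Bi.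
  by apply: sp => //; rewrite in_fset_set // inE.
elim=> [|i l [s Us sp]]; first by exists (p i0) => //; have [] := pP i0 nU0.
have [Bi|nBi] := pselect (B i); last first.
  exists s => // j; rewrite in_cons => /orP[/eqP -> //|]; exact: sp.
case: (le_total s (p i)) => [spi|pis]; last first.
  by exists s => // j; rewrite in_cons => /orP[/eqP -> //|]; exact: sp.
exists (p i); first by have [] := pP i Bi.2.
move=> j; rewrite in_cons => /orP[/eqP -> //|jl Bj].
by apply: le_trans spi; exact: sp.
Qed.

Lemma fibre_nested U i j : fibre J U i -> fibre J U j ->
  J i `<=` J j \/ J j `<=` J i.
Proof.
move=> [_ ui] [_ uj].
have [h|/existsNP[a /not_implyP[Ja nJa]]] := pselect (J i `<=` J j); first by left.
right=> b Jb.
have [z Jz za] : up (J j) a by rewrite uj -ui; exact: sub_up.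
have [w Jw wb] : up (J i) b by rewrite ui -uj; exact: sub_up.
case: (le_total a b) => [ab|ba]; first by case: nJa; exact: (conv Jz Jb).
exact: (conv Jw Ja).
Qed.

End OneBarcode.

(** With [s] just inside [up A] and [s'] just outside, the bars of this birth through [y] number
    [cnt J s y - cnt J s' y], and [H1] compares such differences. If neither side has bars born
    earlier there may be no [s'], and [H0] decides. *)
Lemma fibre_card_le (I I' : choiceType) (J : I -> set T) (J' : I' -> set T)
    (A : set T) (x y : T) :
  (forall i, le_convex (J i)) -> (forall i, le_convex (J' i)) ->
  (forall x, finite_set [set i | J i x]) ->
  (forall x, finite_set [set i | J' i x]) ->
  up A x -> up A y ->
  (forall s, le s x -> le s y -> (cnt J s y <= cnt J' s x)%N) ->
  (forall s' s, le s' s -> le s x -> le s y ->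
     (cnt J s y + cnt J' s' x <= cnt J' s x + cnt J s' y)%N) ->
  (ncard [set i | fibre J (up A) i /\ J i y] <=
   ncard [set i | fibre J' (up A) i /\ J' i x])%N.
Proof.
move=> cJ cJ' fJ fJ' Ux Uy H0 H1; set U := up A in Ux Uy *.
have [a Ua aP] := stable_inside cJ fJ Uy.
have [a' Ua' aP'] := stable_inside cJ' fJ' Ux.
have [s [Us [sx sy] [sa sa']]] :
    exists s, [/\ U s, le s x /\ le s y & le s a /\ le s a'].
  have lb u v : U u -> U v -> exists w, [/\ U w, le w u & le w v].
    by case: (le_total u v) => uv Uu Uv; [exists u|exists v]; split=> //; exact: le_refl.
  have [u [Uu ux uy]] := lb _ _ Ux Uy.
  have [w [Uw wa wa']] := lb _ _ Ua Ua'.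
  have [s [Us su sw]] := lb _ _ Uu Uw.
  exists s; split=> //; first by split; apply: (le_trans su).
  by split; apply: (le_trans sw).
have E (K : choiceType) (L : K -> set T) z : finite_set [set i | L i z] ->
    (forall i, L i z -> L i s <-> U `<=` up (L i)) ->
    (ncard [set i | fibre L U i /\ L i z] +
      ncard [set i | L i z /\ (U `<=` up (L i) /\ ~ (up (L i) `<=` U))])%N
    = cnt L s z.
  move=> fL LP; rewrite /cnt -(@ncardID _ [set i | L i s /\ L i z]
    [set i | L i z /\ (U `<=` up (L i) /\ ~ (up (L i) `<=` U))]); last 2 first.
  - by apply: sub_finite_set fL => i [].
  - by move=> i [Lz [h _]]; split=> //; exact/LP.
  congr (ncard _ + _)%N; apply/seteqP; split=> i /=.
    move=> [[_ e] Lz]; split; first by split=> //; apply/LP => //; rewrite e.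
    by move=> [_ [_]]; rewrite e; apply; exact: subset_refl.
  move=> [[Ls Lz] h]; have Ul : U `<=` up (L i) by apply/LP.
  split=> //; split; first by exists z.
  apply/seteqP; split=> //; apply: contrapT => nh; apply: h; by split.
have {aP} := E _ J y (fJ y) (aP s Us sa).
have {aP'} := E _ J' x (fJ' x) (aP' s Us sa').
set N := ncard [set i | fibre J _ _ /\ _]; set N' := ncard [set i | fibre J' _ _ /\ _].
set M := ncard [set i | J i y /\ _]; set M' := ncard [set i | J' i x /\ _].
move=> e' e.
have [o1 o2] := stable_outside cJ fJ Uy.
have [o1' o2'] := stable_outside cJ' fJ' Ux.
have [[n n']|] := pselect ((forall i, J i y -> up (J i) `<=` U) /\
                          (forall i, J' i x -> up (J' i) `<=` U)).
  have M0 : M = 0%N.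
    rewrite /M (_ : mkset _ = set0) /ncard ?fset_set0 //.
    by apply/seteqP; split=> // i [/n ? []].
  have M0' : M' = 0%N.
    rewrite /M' (_ : mkset _ = set0) /ncard ?fset_set0 //.
    by apply/seteqP; split=> // i [/n' ? []].
  by have := H0 s sx sy; rewrite -e -e' M0 M0' !addn0.
move=> nn'.
(* If only one family has bars born earlier, its bound serves for both. *)
have [s' nUs' [sP sP']] : exists2 s', ~ U s' &
   (forall i, J i y -> ~ (up (J i) `<=` U) -> J i s') /\
   (forall i, J' i x -> ~ (up (J' i) `<=` U) -> J' i s').
  case: o2 => [n|[b nUb bP]]; case: o2' => [n'|[b' nUb' bP']].
  - by case: nn'.
  - exists b' => //; split=> [i /n //|]; exact: bP'.
  - exists b => //; split=> [|i /n' //]; exact: bP.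
  case: (le_total b b') => bb.
    by exists b' => //; split; [exact: bP|exact: bP'].
  by exists b => //; split; [exact: bP|exact: bP'].
have s's : le s' s by exact: le_upN nUs'.
have := H1 s' s s's sx sy; rewrite -e -e'.
have F (K : choiceType) (L : K -> set T) z : U z ->
    (forall i, L i s' -> ~ (up (L i) `<=` U)) ->
    (forall i, L i z -> ~ (up (L i) `<=` U) -> L i s') ->
    cnt L s' z = ncard [set i | L i z /\ (U `<=` up (L i) /\ ~ (up (L i) `<=` U))].
  move=> Uz h1 h2; congr ncard; apply/seteqP; split=> i /= [].
    by move=> Ls Lz; do !split=> //; [exact: up_chain (h1 i Ls)|exact: h1].
  by move=> Lz [_ n]; split=> //; exact: h2.
rewrite (F _ J y) //; last by move=> i; exact: o1.
rewrite (F _ J' x) //; last by move=> i; exact: o1'.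
by rewrite -/M -/M' -addnA -addnA (addnC M M') leq_add2r.
Qed.

(** Within one birth the bars through a point are an initial segment of the ranking, so [f]
    preserves birth and rank, and counts decide containment. [P y x] stands for the shift: y = rho x
    for births, x = rho y for deaths. *)
Theorem half_matching (I I' : choiceType) (J : I -> set T) (J' : I' -> set T)
    (P : T -> T -> Prop) :
  (forall i, le_convex (J i)) -> (forall i, le_convex (J' i)) ->
  (forall x, finite_set [set i | J i x]) ->
  (forall x, finite_set [set i | J' i x]) ->
  (forall i, J' i !=set0) ->
  (forall s x, le s x -> (cnt J' s x <= cnt J s x)%N) ->
  (forall s' s x, le s' s -> le s x ->
     (cnt J' s x + cnt J s' x <= cnt J s x + cnt J' s' x)%N) ->
  (forall s x y, P y x -> le s x -> le s y -> (cnt J s y <= cnt J' s x)%N) ->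
  (forall s' s x y, P y x -> le s' s -> le s x -> le s y ->
     (cnt J s y + cnt J' s' x <= cnt J' s x + cnt J s' y)%N) ->
  exists f : I' -> I, [/\ injective f, forall i, up (J' i) = up (J (f i)),
    forall i, J' i `<=` J (f i) &
    forall i x y, P y x -> J i x -> J i y -> exists2 i', f i' = i & J' i' x].
Proof.
move=> cJ cJ' fJ fJ' nJ' H0 H1 K0 K1.
have /choice[r rP] U := @ranking _ _ (fibre J U) J
  (fun i j => @fibre_nested _ J cJ U i j)
  (fun x => sub_finite_set (@subIsetr _ _ _) (fJ x))
  (fun i (h : fibre J U i) => h.1).
have /choice[r' rP'] U := @ranking _ _ (fibre J' U) J'
  (fun i j => @fibre_nested _ J' cJ' U i j)
  (fun x => sub_finite_set (@subIsetr _ _ _) (fJ' x))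
  (fun i (h : fibre J' U i) => h.1).
have le1 A x : up A x -> (ncard [set i | fibre J' (up A) i /\ J' i x] <=
    ncard [set i | fibre J (up A) i /\ J i x])%N.
  by move=> Ux; apply: fibre_card_le => // [s sx _|s' s s's sx _]; [exact: H0|exact: H1].
have le2 A x y : P y x -> up A x -> up A y ->
    (ncard [set i | fibre J (up A) i /\ J i y] <=
     ncard [set i | fibre J' (up A) i /\ J' i x])%N.
  by move=> Pyx Ux Uy; apply: fibre_card_le => // [s|s' s]; [exact: K0|exact: K1].
have fib' i : fibre J' (up (J' i)) i by split.
have /choice[f fP] i' : exists i, fibre J (up (J' i')) i /\
    r (up (J' i')) i = r' (up (J' i')) i'.
  have [x Jx] := nJ' i'; have [_ /(_ x)[+ _]] := rP' (up (J' i')).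
  move=> /(_ i' (fib' i'))[/(_ Jx) lt _].
  have [_ /(_ x)[_ h]] := rP (up (J' i')).
  by have [i [? _ ?]] := h _ (leq_trans lt (le1 _ _ (sub_up Jx))); exists i.
have sub i' : J' i' `<=` J (f i').
  move=> x Jx; have [fib e] := fP i'.
  have [_ /(_ x)[h _]] := rP (up (J' i')); apply/(h _ fib); rewrite e.
  apply: leq_trans (le1 _ _ (sub_up Jx)).
  by have [_ /(_ x)[h' _]] := rP' (up (J' i')); exact/(h' _ (fib' i')).
exists f; split=> // [i j fij|i|i x y Pyx Jx Jy].
- have [[_ ui] ri] := fP i; have [[_ uj] rj] := fP j.
  have u : up (J' i) = up (J' j) by rewrite -ui -uj fij.
  have [inj _] := rP' (up (J' i)); apply: inj; first exact: fib'.
    by rewrite u; exact: fib'.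
  by rewrite -ri fij u rj.
- by have [[_ ->] _] := fP i.
have fib : fibre J (up (J i)) i by split=> //; exists x.
have [inj /(_ y)[h _]] := rP (up (J i)).
have lt := (h i fib).1 Jy.
have [_ /(_ x)[_ h']] := rP' (up (J i)).
have [i' [[_ u] Jx' e]] := h' _ (leq_trans lt (le2 _ _ _ Pyx (sub_up Jx) (sub_up Jy))).
exists i' => //; have [fb e'] := fP i'; rewrite u in fb e'.
by apply: inj => //; rewrite e'.
Qed.

End HalfMatching.

(** * Barcode bases and interval decompositions *)

Section RowSum.
Variable k : fieldType.
Implicit Types b c : bool.

(** The coordinate of a vector in a space of dimension 0 or 1, without casts between the two
    types. *)
Definition rowsum n (v : 'rV[k]_n) : k := \sum_(j < n) v 0 j.

Lemma rowsum_inj b : injective (@rowsum b).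
Proof.
case: b => v w; last by rewrite (thinmx0 v) (thinmx0 w).
by rewrite /rowsum !big_ord1 => e; apply/rowP => j; rewrite !ord1.
Qed.

Lemma rowsum_const b a : rowsum (const_mx a : 'rV[k]_b) = if b then a else 0.
Proof. by case: b; rewrite /rowsum (big_ord0, big_ord1) ?mxE. Qed.

Lemma rowsum_off b (v : 'rV[k]_b) : ~~ b -> rowsum v = 0.
Proof. by case: b v => // v _; rewrite /rowsum big_ord0. Qed.

Lemma rowsumM b c (v : 'rV[k]_b) :
  rowsum (v *m const_mx 1 : 'rV[k]_c) = if c then rowsum v else 0.
Proof.
rewrite /rowsum; case: c; rewrite (big_ord0, big_ord1) // mxE.
by apply: eq_bigr => j _; rewrite mxE mulr1.
Qed.

End RowSum.

Section RowScale.
Variables (k : fieldType) (U : vectType k) (n : nat) (u : U).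

Definition row_scale (v : 'rV[k]_n) : U := rowsum v *: u.

Fact row_scale_is_linear : linear row_scale.
Proof.
move=> a v w; rewrite /row_scale /rowsum scalerA -scalerDl mulr_sumr -big_split /=.
by congr (_ *: _); apply: eq_bigr => j _; rewrite !mxE.
Qed.

HB.instance Definition _ :=
  GRing.isLinear.Build k 'rV[k]_n U _ row_scale row_scale_is_linear.

End RowScale.

Lemma dinterval_nonempty (R : realType) (b d : decorated R) :
  dinterval b d !=set0 <-> (b < d)%O.
Proof. by rewrite -[(b < d)%O](neitvE (Interval b d)); split=> [/set0P|/set0P]. Qed.

Lemma dinterval_is_interval (R : realType) (b d : decorated R) :
  is_interval (dinterval b d).
Proof. exact: interval_is_interval. Qed.

Lemma is_interval_dinterval (R : realType) (A : set R) : is_interval A ->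
  exists b d, A = dinterval b d.
Proof.
move=> Aint; exists (Rhull A).1, (Rhull A).2.
by rewrite /dinterval -[in LHS](RhullK (mem_set Aint)); case: Rhull.
Qed.

Section OfDecomposition.
Variables (k : fieldType) (R : realType) (V : pfdModule k R).
Variable D : interval_decomposition V.

Let b := @dec_birth _ _ _ D.
Let d := @dec_death _ _ _ D.
Definition dec_set (i : dec_index D) : set R := dinterval (b i) (d i).
Definition dec_vect (i : dec_index D) (t : R) : V t :=
  Defs.dec_inj i t (const_mx 1 : imod_space k (b i) (d i) t).

Let rv_off i t (v : imod_space k (b i) (d i) t) : ~ dec_set i t -> v = 0.
Proof.
by rewrite /imod_space in v * => /negP/negPf h; move: v; rewrite h => v; exact: thinmx0.
Qed.

Let rv_on i t (v : imod_space k (b i) (d i) t) : dec_set i t ->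
  exists c, v = c *: (const_mx 1 : imod_space k (b i) (d i) t).
Proof.
rewrite /dec_set /dinterval /= /imod_space in v * => h; move: v; rewrite h => v.
by exists (v 0 0); apply/rowP => j; rewrite !mxE !ord1 mulr1.
Qed.

Let rv_coef i t c : dec_set i t ->
  c *: (const_mx 1 : imod_space k (b i) (d i) t) = 0 -> c = 0.
Proof.
rewrite /dec_set /dinterval /= /imod_space => h; rewrite h => /rowP /(_ 0).
by rewrite !mxE mulr1.
Qed.

(** A relation, extended by zero, is a finitely supported family with sum 0, and 0 has only one such
    family. *)
Lemma dec_vect_free t (s : seq (dec_index D)) : uniq s ->
  {in s, forall i, dec_set i t} -> free [seq dec_vect i t | i <- s].
Proof.
move=> us st; apply/free_map => // c c0.
have [z [_ zu]] := @dec_sum _ _ _ D t 0.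
pose y i : interval_module k (dec_birth i) (dec_death i) t :=
  if i \in s then c i *: (const_mx 1 : imod_space k (b i) (d i) t) else 0.
have y0 : z = y.
  apply: zu; split.
    apply: (@sub_finite_set _ _ [set` s]); last exact: finite_seq.
    by move=> i /=; rewrite /y; case: ifP => //; rewrite eqxx.
  rewrite -[LHS]c0; rewrite (fsbigTE [fset i in s]%fset); last first.
    by move=> i; rewrite inE /= /y => /negPf ->; rewrite linear0.
  rewrite [RHS](perm_big s) /=; last first.
    by apply: uniq_perm; rewrite ?fset_uniq // => i; rewrite inE.
  rewrite big_seq [RHS]big_seq; apply: eq_bigr => i si.
  by rewrite /y si linearZ.
have z0 : z = fun i => 0.
  apply: zu; split; last by rewrite fsbig1 // => i _; rewrite linear0.
  by rewrite (_ : mkset _ = set0) //; apply/seteqP; split=> // i /=; rewrite eqxx.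
move=> i si; apply: (@rv_coef i t); first exact: st.
have : y i = 0 by rewrite -y0 z0.
by rewrite /y si.
Qed.

Lemma decomposition_barcode_basis : barcode_basis dec_set dec_vect.
Proof.
have fin t : finite_set [set i | dec_set i t].
  by apply: (@finite_set_free _ _ _ (dec_vect^~ t)) => s us st; exact: dec_vect_free.
split=> //.
- by move=> i; exact: dinterval_is_interval.
- by move=> i; apply/dinterval_nonempty; exact: dec_nonempty.
- by move=> i t nt; rewrite /dec_vect (rv_off (const_mx 1) nt) linear0.
- move=> i s t st Js; rewrite pmfE /dec_vect.
  have := congr1 (fun f => fun_of_lfun f (const_mx 1 : imod_space k (b i) (d i) s))
    (mor_natural (Defs.dec_inj i) st); rewrite !comp_lfunE => <-.
  congr (Defs.dec_inj i t _); rewrite imod_mapE.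
  apply/matrixP => p q; rewrite !mxE; under eq_bigr do rewrite !mxE mulr1.
  by move: Js; rewrite /dec_set /dinterval /= => ->; rewrite big_ord1.
- move=> t; rewrite /basis_of dec_vect_free ?andbT; last 2 first.
  + exact: fset_uniq.
  + by move=> i; rewrite in_fset_set // => /set_mem.
  apply/eqP/vspaceP => v; rewrite memvf.
  have [z [[zf ->] _]] := @dec_sum _ _ _ D t v.
  rewrite (fsbigTE (fset_set [set i | z i != 0])); last first.
    move=> i /negP iz; suff -> : z i = 0 by rewrite linear0.
    by apply: contrapT => /eqP zi; apply: iz; rewrite in_fset_set // inE.
  apply: memv_suml => i _.
  have [it|nit] := pselect (dec_set i t); last by rewrite (rv_off (z i) nit) linear0 mem0v.
  have [c ->] := rv_on (z i) it; rewrite linearZ /=; apply: memvZ.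
  by apply/memv_span/(map_f (fun i => dec_vect i t)); rewrite in_fset_set // inE.
Qed.

(** The position among equal bars is shifted by one because copies in a diagram are numbered from
    1. *)
Definition dec_label (i : dec_index D) : decorated R * decorated R * nat :=
  (b i, d i, (index i (enum_fset (fset_set
     [set j | b j = b i /\ d j = d i]))).+1).

Let class_finite i : finite_set [set j | b j = b i /\ d j = d i].
Proof.
have [t it] : dec_set i !=set0 by apply/dinterval_nonempty; exact: dec_nonempty.
have [_ _ _ _ fin _] := decomposition_barcode_basis.
apply: sub_finite_set (fin t) => j [bj dj].
by rewrite /dec_set /= bj dj.
Qed.

Lemma dec_label_inj : injective dec_label.
Proof.
move=> i j [bij dij]; rewrite bij dij; apply: (index_inj i).
  by rewrite in_fset_set; [rewrite inE|rewrite -bij -dij; exact: class_finite].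
by rewrite in_fset_set ?inE //; exact: class_finite.
Qed.

Lemma dec_label_range : range dec_label = diagram_of D.
Proof.
apply/seteqP; split=> [_ [i _ <-]|[[b' d'] n] [m [/= card /andP[n0 nm]]]].
  exists #|` fset_set [set j | b j = b i /\ d j = d i]|; split.
    have /card_eq_fsetP := erefl #|` fset_set [set j | b j = b i /\ d j = d i]|.
    by rewrite fset_setK //; exact: class_finite.
  by rewrite /= index_mem in_fset_set ?inE //; exact: class_finite.
have fC : finite_set [set i | b i = b' /\ d i = d'] by exists m.
case: n n0 nm => // n _ nm.
have sm : size (enum_fset (fset_set [set i | b i = b' /\ d i = d'])) = m.
  exact: card_fset_set card.
case E : (enum_fset (fset_set [set i | b i = b' /\ d i = d'])) => [|i0 l].
  by move: nm; rewrite -sm E.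
pose i := nth i0 (enum_fset (fset_set [set i | b i = b' /\ d i = d'])) n.
have ns : (n < size (enum_fset (fset_set [set i | b i = b' /\ d i = d'])))%N.
  by rewrite sm.
have : i \in fset_set [set i | b i = b' /\ d i = d'] by rewrite mem_nth.
rewrite in_fset_set // => /set_mem [ib id].
by exists i => //; rewrite /dec_label ib id index_uniq ?fset_uniq.
Qed.

End OfDecomposition.

Section ToDecomposition.
Variables (k : fieldType) (R : realType) (V : pfdModule k R).
Variables (I : choiceType) (J : I -> set R) (x : forall (i : I) (t : R), V t).
Hypothesis bar : barcode_basis J x.

(** Only existence is recorded: it makes the set from which [PD] chooses nonempty, and bars are then
    read off the decomposition so chosen. *)
Lemma decomposition_of_barcode_basis : exists D : interval_decomposition V, True.
Proof.
have [Jint Jne Joff Jmap Jfin Jbasis] := bar.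
have /choice[b /choice[d JE]] i := is_interval_dinterval (Jint i).
have bd i : (b i < d i)%O by apply/dinterval_nonempty; rewrite -JE.
have JP i t : J i t = (t \in Interval (b i) (d i)) by rewrite JE.
pose f i t : 'Hom(interval_module k (b i) (d i) t, V t) := linfun (row_scale (x i t)).
have fE i t v : f i t v = row_scale (x i t) v by rewrite lfunE.
have fnat i s t (st : s <= t) : (f i t \o pm_map (interval_module k (b i) (d i)) st =
    pm_map V st \o f i s)%VF.
  apply/lfunP => v; rewrite !comp_lfunE !fE imod_mapE -pmfE /row_scale linearZ /=.
  rewrite rowsumM; have [Js|nJs] := pselect (J i s); last first.
    rewrite (Joff _ _ nJs) linear0 scaler0 rowsum_off ?if_same ?scale0r //.
    by apply/negP; rewrite -JP.
  rewrite Jmap //; case: ifPn => // nt; rewrite Joff ?scaler0 // JP.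
  exact/negP.
pose iota i := Morphism (fnat i).
suff sum : is_direct_sum iota by exists (IntervalDecomposition bd sum).
move=> t v; set F := fset_set [set i | J i t].
have FP i : (i \in F) <-> J i t by rewrite in_fset_set ?inE.
have sumF (y : forall i, interval_module k (b i) (d i) t) :
    finite_set [set i | y i != 0] /\ \sum_(i \in [set: I]) iota i t (y i) =
      \sum_(i <- F) rowsum (y i : imod_space k (b i) (d i) t) *: x i t.
  have y0 i : i \notin F -> y i = 0.
    move=> /negP iF; apply: rowsum_inj; rewrite (rowsum_off (0 : 'rV_(t \in _))) ?rowsum_off //;
      by apply/negP; rewrite -JP => /FP.
  split; first by apply: (@sub_finite_set _ _ [set` F]); [
    move=> i /=; apply: contraNT => /y0 ->; rewrite eqxx|exact: finite_fset].
  rewrite (fsbigTE F) => [|i /y0 ->]; last by rewrite linear0.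
  by apply: eq_bigr => i _; rewrite /= fE.
have : v \in <<[seq x i t | i <- F]>>%VS by rewrite (span_basis (Jbasis t)) memvf.
move=> /(memv_span_map (fun i => x i t) v (fset_uniq F))[c vc].
pose y i : interval_module k (b i) (d i) t := const_mx (c i) : imod_space k (b i) (d i) t.
have yE i : i \in F -> rowsum (y i : imod_space k (b i) (d i) t) = c i.
  by move=> /FP; rewrite JP => Jt; rewrite rowsum_const Jt.
exists y; split.
  have [fy ->] := sumF y; split=> //; rewrite vc big_seq [RHS]big_seq.
  by apply: eq_bigr => i iF; rewrite yE.
move=> y' [_]; have [_ ->] := sumF y' => vy'.
apply: functional_extensionality_dep => i.
apply: rowsum_inj; have [/FP iF|nJ] := pselect (J i t); last first.
  by rewrite !rowsum_off //; apply/negP; rewrite -JP.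
rewrite yE //.
have /free_map h := basis_free (Jbasis t).
have := h (fset_uniq F) (fun i => c i - rowsum (y' i : imod_space k (b i) (d i) t)).
move=> /(_ _ i iF).
have -> : \sum_(i <- F) (c i - rowsum (y' i : imod_space k (b i) (d i) t)) *: x i t = 0.
  under eq_bigr do rewrite scalerBl.
  by rewrite sumrB -vc -vy' subrr.
by move=> /(_ erefl) /eqP; rewrite subr_eq0 => /eqP.
Qed.

End ToDecomposition.

Lemma PD_labelling (k : fieldType) (R : realType) (V : pfdModule k R) :
  exists (I : choiceType) (b d : I -> decorated R) (x : forall i t, V t)
    (e : I -> decorated R * decorated R * nat),
  [/\ barcode_basis (fun i => dinterval (b i) (d i)) x, injective e,
      range e = PD V & forall i, (e i).1 = (b i, d i)].
Proof.
have [I [J [x bar]]] := barcode_basis_exists V.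
have [D0 _] := decomposition_of_barcode_basis bar.
have [D PDE] : exists D : interval_decomposition V, PD V = diagram_of D.
  by apply: (@xgetPex _ set0 [set P | exists D : interval_decomposition V, P = diagram_of D]);
    exists (diagram_of D0), D0.
exists (dec_index D), (@dec_birth _ _ _ D), (@dec_death _ _ _ D), (@dec_vect _ _ _ D),
  (@dec_label _ _ _ D); split=> //.
- exact: decomposition_barcode_basis.
- exact: dec_label_inj.
- by rewrite PDE dec_label_range.
Qed.

Section BarcodeCount.
Variables (k : fieldType) (R : realType) (V : pfdModule k R).
Variables (I : choiceType) (J : I -> set R) (x : forall (i : I) (t : R), V t).
Hypothesis bar : barcode_basis J x.

(** Basis vectors at [s] go to basis vectors at [t] or to 0, so the bars alive at both points give a
    basis of the image. *)
Lemma cnt_rank s t : s <= t -> cnt J s t = \dim (limg (pmf V s t)).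
Proof.
have [_ _ Joff Jmap Jfin Jbasis] := bar => st.
set G := fset_set [set i | J i s /\ J i t].
have fG : finite_set [set i | J i s /\ J i t] by apply: sub_finite_set (Jfin s) => i [].
have -> : limg (pmf V s t) = <<[seq x i t | i <- G]>>%VS.
  rewrite -(span_basis (Jbasis s)) limg_span -map_comp.
  apply/eqP; rewrite eqEsubv; apply/andP; split; apply/span_subvP => _ /mapP[i + ->].
    rewrite in_fset_set // => /set_mem is_; rewrite /= Jmap //.
    have [it|nit] := pselect (J i t); last by rewrite Joff // mem0v.
    by apply/memv_span/(map_f (fun i => x i t)); rewrite in_fset_set // inE.
  rewrite in_fset_set // => /set_mem [is_ it]; rewrite -(Jmap _ _ _ st is_).
  apply/memv_span/(map_f (fun i => pmf V s t (x i s))).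
  by rewrite in_fset_set // inE.
suff /eqP -> : free [seq x i t | i <- G] by rewrite size_map.
have FG : perm_eq (enum_fset (fset_set [set i | J i t]))
    (enum_fset G ++ [seq i <- enum_fset (fset_set [set i | J i t]) | i \notin G]).
  apply: uniq_perm; rewrite ?fset_uniq // ?cat_uniq ?filter_uniq ?fset_uniq ?andbT //=.
    by apply/hasPn => i; rewrite mem_filter => /andP[].
  move=> i; rewrite mem_cat mem_filter; case iG : (i \in G) => //=.
  by move: iG; rewrite in_fset_set // => /set_mem [_ it]; rewrite in_fset_set // mem_set.
have := basis_free (Jbasis t); rewrite (perm_free (perm_map _ FG)) map_cat.
exact: catl_free.
Qed.

End BarcodeCount.

(** * The induced matching *)

Section ImageModule.
Variables (k : fieldType) (R : realType) (V U : pfdModule k R).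
Variable phi : pm_morphism V U.

Definition im_mod_space (t : R) : vectType k := subvs_of (limg (phi t)).

Definition im_mod_map (s t : R) (st : s <= t) : 'Hom(im_mod_space s, im_mod_space t) :=
  (linfun (vsproj (limg (phi t))) \o (pm_map U st \o linfun vsval))%VF.

Lemma im_mod_mapE s t (st : s <= t) (w : im_mod_space s) :
  vsval (im_mod_map st w) = pm_map U st (vsval w).
Proof.
rewrite !comp_lfunE !lfunE /= vsprojK //.
have /memv_imgP[v _ ->] := subvsP w.
by rewrite -comp_lfunE -mor_natural comp_lfunE memv_img ?memvf.
Qed.

Lemma im_mod_map_id t (tt : t <= t) : im_mod_map tt = \1%VF.
Proof.
by apply/lfunP => w; apply: subvs_inj; rewrite im_mod_mapE pm_map_id !id_lfunE.
Qed.

Lemma im_mod_map_comp r s t (rs : r <= s) (st : s <= t) (rt : r <= t) :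
  (im_mod_map st \o im_mod_map rs)%VF = im_mod_map rt.
Proof.
apply/lfunP => w; apply: subvs_inj; rewrite comp_lfunE !im_mod_mapE.
by rewrite -(pm_map_comp U rs st rt) comp_lfunE.
Qed.

Definition image_module : pfdModule k R := PfdModule im_mod_map_id im_mod_map_comp.

Lemma image_module_rank s t : s <= t ->
  \dim (limg (pmf image_module s t)) = \dim (pmf U s t @: limg (phi s)).
Proof.
move=> st; pose i t : 'Hom(im_mod_space t, U t) := linfun vsval.
have ker_i r : lker (i r) == 0%VS.
  by apply/lker0P => v w; rewrite !lfunE; exact: subvs_inj.
rewrite -(@limg_dim_eq _ _ _ (i t)); last by rewrite (eqP (ker_i t)) capv0.
congr (\dim _); rewrite !pmfE -[LHS]limg_comp.
have -> : (i t \o pm_map image_module st = pm_map U st \o i s)%VF.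
  apply/lfunP => w; rewrite [LHS]comp_lfunE [RHS]comp_lfunE [LHS]lfunE [in RHS]lfunE.
  exact: im_mod_mapE.
rewrite limg_comp; congr (_ @: _)%VS; apply/vspaceP => v; apply/idP/idP.
  by move=> /memv_imgP[w _ ->]; rewrite lfunE; exact: subvsP.
by move=> vi; rewrite -(vsprojK vi) -[vsval _](lfunE vsval) memv_img ?memvf.
Qed.

End ImageModule.

(** * Matching by births, matching by deaths, and their composite *)

Section InducedMatching.
Variables (k : fieldType) (R : realType) (V W : pfdModule k R).
Variables (tau sigma : R -> R).
Hypotheses (tau_mono : monotone tau) (rho_ge : forall x, x <= sigma (tau x)).
Variables (f : forall t, 'Hom(V t, W (tau t))) (g : forall t, 'Hom(W (tau t), V (sigma (tau t)))).
Hypothesis f_nat : forall s t v, s <= t ->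
  pmf W (tau s) (tau t) (f s v) = f t (pmf V s t v).
Hypothesis gf : forall t v, g t (f t v) = pmf V t (sigma (tau t)) v.
Hypothesis fg : forall t w, f (sigma (tau t)) (g t w) =
  pmf W (tau t) (tau (sigma (tau t))) w.

Variables (I I' IQ : choiceType) (J : I -> set R) (J' : I' -> set R) (M : IQ -> set R).
Hypothesis J_int : forall i, is_interval (J i).
Hypothesis J'_int : forall i, is_interval (J' i).
Hypothesis M_int : forall i, is_interval (M i).
Hypothesis J_fin : forall x, finite_set [set i | J i x].
Hypothesis J'_fin : forall x, finite_set [set i | J' i x].
Hypothesis M_fin : forall x, finite_set [set i | M i x].
Hypothesis M_ne : forall i, M i !=set0.
Hypothesis J_cnt : forall s t, s <= t -> cnt J s t = \dim (limg (pmf V s t)).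
Hypothesis J'_cnt : forall s t, s <= t -> cnt J' s t = \dim (limg (pmf W s t)).
Hypothesis M_cnt : forall s t, s <= t ->
  cnt M s t = \dim (pmf W (tau s) (tau t) @: limg (f s)).

Let rho x := sigma (tau x).
(** The bars of W(tau); their counts are those of [J'] at points moved by [tau]. *)
Let K i := tau @^-1` J' i.
Let leR (x y : R) : Prop := x <= y.
Let geR (x y : R) : Prop := y <= x.

Let M_cnt' s t : s <= t -> cnt M s t = \dim (f t @: limg (pmf V s t)).
Proof.
move=> st; rewrite M_cnt //; congr (\dim _); rewrite -!limg_comp.
by apply: eq_in_limg => v _; rewrite !comp_lfunE f_nat.
Qed.

Let K_cnt s t : s <= t -> cnt K s t = \dim (limg (pmf W (tau s) (tau t))).
Proof. by move=> st; rewrite -J'_cnt //; exact: tau_mono. Qed.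

(** [f] maps the image of V from [s] to [x] onto that of Q, and [g] maps the latter onto the image
    of V from [s] to [rho x]. Neither ranks nor their differences can grow along these maps. *)
Lemma birth_matching : exists F : IQ -> I, [/\ injective F,
  forall i, up leR (M i) = up leR (J (F i)),
  forall i, M i `<=` J (F i) &
  forall i x, J i x -> J i (rho x) -> exists2 q, F q = i & M q x].
Proof.
have Vrho s x : s <= x -> limg (pmf V s (rho x)) = (g x @: (f x @: limg (pmf V s x)))%VS.
  move=> sx; rewrite -(pmf_limg_comp _ sx (rho_ge x)) -[RHS]limg_comp.
  by apply: eq_in_limg => v _; rewrite comp_lfunE gf.
have [F [Finj Fup Fsub Fcov]] : exists F : IQ -> I, [/\ injective F,
    forall i, up leR (M i) = up leR (J (F i)),
    forall i, M i `<=` J (F i) &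
    forall i x y, y = rho x -> J i x -> J i y -> exists2 q, F q = i & M q x].
  apply: (@half_matching _ leR) => //.
  - by move=> x; exact: lexx.
  - by move=> x y z; exact: le_trans.
  - by move=> x y; apply/orP; exact: le_total.
  - by move=> i x y z Jx Jy xz zy; apply: (J_int Jx Jy); rewrite xz.
  - by move=> i x y z Jx Jy xz zy; apply: (M_int Jx Jy); rewrite xz.
  - by move=> s x sx; rewrite M_cnt' // J_cnt // dim_limg_le.
  - move=> s' s x ss sx; have s'x := le_trans ss sx.
    by rewrite !M_cnt' // !J_cnt // dim_limg_diff // limg_pmf_le.
  - move=> s x _ -> sx sy; rewrite M_cnt' // J_cnt // Vrho // dim_limg_le //.
  - move=> s' s x _ -> ss sx sy; have s'x := le_trans ss sx; have s'y := le_trans ss sy.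
    rewrite !M_cnt' // !J_cnt // !Vrho // dim_limg_diff // limgS // limg_pmf_le //.
by exists F; split=> // i x Jx Jy; exact: Fcov Jx Jy.
Qed.

(** Here subspaces are compared: the image of W(tau) from [x] to [rho x] lies in Q, which lies in
    W(tau). The order is reversed, and [cntC] restores the arguments for the rank formulas. *)
Lemma death_matching : exists G : IQ -> I', [/\ injective G,
  forall i, up geR (M i) = up geR (K (G i)),
  forall i, M i `<=` K (G i) &
  forall i x, K i x -> K i (rho x) -> exists2 q, G q = i & M q (rho x)].
Proof.
have cmp x s s' (A : {vspace W (tau x)}) : x <= s -> s <= s' ->
    (pmf W (tau x) (tau s') @: A =
     pmf W (tau s) (tau s') @: (pmf W (tau x) (tau s) @: A))%VS.
  by move=> xs ss; rewrite pmf_limg_comp //; exact: tau_mono.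
have Wrho x : (limg (pmf W (tau x) (tau (rho x))) <= limg (f (rho x)))%VS.
  by apply/subvP => _ /memv_imgP[w _ ->]; rewrite -fg memv_img ?memvf.
have [G [Ginj Gup Gsub Gcov]] : exists G : IQ -> I', [/\ injective G,
    forall i, up geR (M i) = up geR (K (G i)),
    forall i, M i `<=` K (G i) &
    forall i x y, x = rho y -> K i x -> K i y -> exists2 q, G q = i & M q x].
  apply: (@half_matching _ geR) => //.
  - by move=> x; exact: lexx.
  - by move=> x y z xy yz; exact: le_trans yz xy.
  - by move=> x y; apply/orP; exact: le_total.
  - move=> i x y z Jx Jy zx yz; apply: (J'_int Jy Jx).
    by rewrite !tau_mono.
  - by move=> i x y z Jx Jy zx yz; apply: (M_int Jy Jx); rewrite yz.
  - by move=> x; exact: J'_fin.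
  - move=> s x xs; rewrite cntC (cntC K) M_cnt // K_cnt //.
    by apply: dimvS; apply: limgS; exact: subvf.
  - move=> s' s x ss xs; have xs' := le_trans xs ss.
    rewrite !(cntC M _ x) !(cntC K _ x) !M_cnt // !K_cnt //.
    rewrite !(cmp _ _ _ _ xs ss) addnC; apply: dim_limg_diff.
    by apply: limgS; exact: subvf.
  - move=> s _ y -> xs ys; rewrite cntC (cntC M) M_cnt // K_cnt //.
    rewrite (cmp _ _ _ _ (rho_ge y) xs).
    by apply: dimvS; apply: limgS; exact: Wrho.
  - move=> s' s _ y -> ss xs ys.
    have xs' := le_trans xs ss; have ys' := le_trans ys ss.
    rewrite !(cntC M _ (rho y)) !(cntC K _ y) !M_cnt // !K_cnt //.
    rewrite addnC (cmp _ _ _ _ xs ss) (cmp _ _ _ _ ys ss); apply: dim_limg_diff.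
    by rewrite (cmp _ _ _ _ (rho_ge y) xs); apply: limgS; exact: Wrho.
by exists G; split=> // i x Jx Jy; exact: Gcov Jy Jx.
Qed.

Lemma index_matching : exists X : I -> I' -> Prop,
  [/\ forall i j j', X i j -> X i j' -> j = j',
      forall i i' j, X i j -> X i' j -> i = i',
      forall i j, X i j ->
        [/\ bounded_above_by (rho @^-1` J i) (K j), overlaps_above (J i) (K j)
          & bounds_below (J i) (rho @` K j)],
      forall i, (forall j, ~ X i j) -> trivial_for rho (J i)
    & forall j, (forall i, ~ X i j) -> trivial_for rho (K j)].
Proof.
have [F [Finj Fup Fsub Fcov]] := birth_matching.
have [G [Ginj Gup Gsub Gcov]] := death_matching.
have inJ i a c e : J i a -> J i c -> a <= e -> e <= c -> J i e.
  by move=> Ja Jc ae ec; apply: (J_int Ja Jc); rewrite ae.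
have inK i a c e : K i a -> K i c -> a <= e -> e <= c -> K i e.
  by move=> Ja Jc ae ec; apply: (J'_int Ja Jc); rewrite !tau_mono.
exists (fun i j => exists q, F q = i /\ G q = j); split.
- by move=> i j j' [q [<- <-]] [q' [/Finj -> <-]].
- by move=> i i' j [q [<- <-]] [q' [<- /Ginj ->]].
- move=> _ _ [q [<- <-]]; have [m Mm] := M_ne q; split.
  (* If [x] is in the bar of V, injectivity of [F] makes the bar of Q through [x] the bar [q];
     otherwise [x] precedes that whole bar, and so precedes [m]. *)
  + move=> x /= Jrx; have [Jx|nJx] := pselect (J (F q) x).
      by have [q' /Finj -> Mx] := Fcov _ _ Jx Jrx; exists x => //; exact: Gsub.
    exists m; first exact: Gsub.
    rewrite leNgt; apply/negP => /ltW mx; apply: nJx.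
    exact: inJ (Fsub _ _ Mm) Jrx mx (rho_ge x).
  + split.
    * move=> y Jy; have [x Mx xy] : up leR (M q) y by rewrite Fup; exists y => //; exact: lexx.
      by exists x => //; exact: Gsub.
    * move=> x Kx; have [y My xy] : up geR (M q) x by rewrite Gup; exists x => //; exact: lexx.
      by exists y => //; exact: Fsub.
    * by exists m; split; [exact: Gsub|exact: Fsub].
  (* Dually, [rho x] lies in the bar of Q or beyond all of [K (G q)]. *)
  + move=> _ [x Kx <-]; have [Kr|nKr] := pselect (K (G q) (rho x)).
      have [q' /Ginj -> Mr] := Gcov _ _ Kx Kr; exists (rho x); last exact: lexx.
      exact: Fsub.
    exists m; first exact: Fsub.
    rewrite leNgt; apply/negP => /ltW rm; apply: nKr.
    exact: inK Kx (Gsub _ _ Mm) (rho_ge x) rm.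
- move=> i nX; apply/seteqP; split=> // y [Jr [x Jx xy]].
  rewrite -xy in Jr; have [q Fq _] := Fcov _ _ Jx Jr.
  by case: (nX (G q)); exists q.
- move=> j nX; apply/seteqP; split=> // y [Kr [x Kx xy]].
  rewrite -xy in Kr; have [q Gq _] := Gcov _ _ Kx Kr.
  by case: (nX (F q)); exists q.
Qed.

End InducedMatching.

Theorem theorem4p1 (k : fieldType) (R : realType) (V W : pfdModule k R)
    (tau sigma : R -> R) (tp : translation_pair tau sigma)
    (phi : pm_morphism V (pm_reindex W (tp_monotone1 tp)))
    (psi : pm_morphism W (pm_reindex V (tp_monotone2 tp)))
    (hinter : interleaved_via phi psi) :
  exists X : decorated R * decorated R * nat ->
             decorated R * decorated R * nat -> Prop,
    [/\ is_matching (PD V) (PD W) X,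
        forall (b d b' d' : decorated R) (i i' : nat),
          X (b, d, i) (b', d', i') ->
          [/\ bounded_above_by ((sigma \o tau) @^-1` dinterval b d)
                               (tau @^-1` dinterval b' d'),
              overlaps_above (dinterval b d) (tau @^-1` dinterval b' d')
            & bounds_below (dinterval b d)
                ((sigma \o tau) @` (tau @^-1` dinterval b' d'))],
        forall (b d : decorated R) (i : nat),
          PD V (b, d, i) -> unmatched_source X (b, d, i) ->
          trivial_for (sigma \o tau) (dinterval b d)
      & forall (b' d' : decorated R) (i' : nat),
          PD W (b', d', i') -> unmatched_target X (b', d', i') ->
          dinterval b' d' `&` range tau = set0 \/
          trivial_for (sigma \o tau) (tau @^-1` dinterval b' d')].
Proof.
have [psi_phi phi_psi] := hinter.
have [I [b [d [x [e [bar einj erange eE]]]]]] := PD_labelling V.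
have [I' [b' [d' [x' [e' [bar' e'inj e'range e'E]]]]]] := PD_labelling W.
have [IQ [M [xQ barQ]]] := barcode_basis_exists (image_module phi).
pose f t : 'Hom(V t, W (tau t)) := phi t.
pose g t : 'Hom(W (tau t), V (sigma (tau t))) := psi (tau t).
have tmono := tp_monotone1 tp.
have pmfU s t : s <= t -> pmf (pm_reindex W (tp_monotone1 tp)) s t = pmf W (tau s) (tau t).
  by move=> st; rewrite (pmfE _ st) (pmfE _ (tmono _ _ st)) /=;
    congr (pm_map W _); exact: bool_irrelevance.
have [X [X1 X2 X3 X4 X5]] : exists X : I -> I' -> Prop,
  [/\ forall i j j', X i j -> X i j' -> j = j',
      forall i i' j, X i j -> X i' j -> i = i',
      forall i j, X i j ->
        [/\ bounded_above_by ((sigma \o tau) @^-1` dinterval (b i) (d i))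
                             (tau @^-1` dinterval (b' j) (d' j)),
            overlaps_above (dinterval (b i) (d i)) (tau @^-1` dinterval (b' j) (d' j))
          & bounds_below (dinterval (b i) (d i))
              ((sigma \o tau) @` (tau @^-1` dinterval (b' j) (d' j)))],
      forall i, (forall j, ~ X i j) -> trivial_for (sigma \o tau) (dinterval (b i) (d i))
    & forall j, (forall i, ~ X i j) ->
        trivial_for (sigma \o tau) (tau @^-1` dinterval (b' j) (d' j))].
  apply: (@index_matching k R V W tau sigma tmono (tp_translation21 tp).2 f g _ _ _
    I I' IQ (fun i => dinterval (b i) (d i)) (fun i => dinterval (b' i) (d' i)) M).
  - move=> s t v st; have /lfunP/(_ v) := mor_natural phi st.
    by rewrite !comp_lfunE -(pmfU _ _ st) -!pmfE => ph; exact/esym.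
  - move=> t v; have /lfunP/(_ v) := psi_phi t.
    by rewrite comp_lfunE -pmfE.
  - move=> t w; have /lfunP/(_ w) := phi_psi (tau t).
    by rewrite comp_lfunE -pmfE.
  - by case: bar.
  - by case: bar'.
  - by case: barQ.
  - by case: bar.
  - by case: bar'.
  - by case: barQ.
  - by case: barQ.
  - by move=> s t st; exact: (cnt_rank bar st).
  - by move=> s t st; exact: (cnt_rank bar' st).
  - move=> s t st; rewrite (cnt_rank barQ st) image_module_rank //.
    by rewrite pmfU.
have PDV p : PD V p -> exists i, e i = p.
  by rewrite -erange => -[i _ <-]; exists i.
have PDW p : PD W p -> exists i, e' i = p.
  by rewrite -e'range => -[i _ <-]; exists i.
exists (fun p p' => exists i j, [/\ e i = p, e' j = p' & X i j]); split.
- split.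
  + by move=> _ _ [i [j [<- <- _]]]; rewrite -erange -e'range; split; [exists i|exists j].
  + move=> _ _ _ [i [j [<- <- Xij]]] [i' [j' [/einj ei <- Xij']]].
    by rewrite ei in Xij'; rewrite (X1 _ _ _ Xij Xij').
  + move=> _ _ _ [i [j [<- <- Xij]]] [i' [j' [<- /e'inj ej Xij']]].
    by rewrite ej in Xij'; rewrite (X2 _ _ _ Xij Xij').
- move=> b0 d0 b0' d0' n n' [i [j [ei ej Xij]]].
  have [<- <-] : (b i, d i) = (b0, d0) by rewrite -eE ei.
  have [<- <-] : (b' j, d' j) = (b0', d0') by rewrite -e'E ej.
  exact: X3.
- move=> b0 d0 n /PDV[i ei] nX; have [<- <-] : (b i, d i) = (b0, d0) by rewrite -eE ei.
  by apply: X4 => j Xij; apply: (nX (e' j)); exists i, j.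
- move=> b0 d0 n /PDW[j ej] nX; have [<- <-] : (b' j, d' j) = (b0, d0) by rewrite -e'E ej.
  (* An interval that misses the image of [tau] has empty preimage, which is trivial, so this
     alternative covers both cases. *)
  by right; apply: X5 => i Xij; apply: (nX (e i)); exists i, j.
Qed.
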